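(* Let $Y$ be a Banach space and let $1<p<\infty$. Then $L_p([0,1],Y)$ admits an equivalent asymptotically midpoint uniformly convex norm if and only if $Y$ admits an equivalent uniformly convex norm.
   Context: $L_p([0,1],Y)$ is the Bochner space. The norm of a Banach space $X$ is asymptotically midpoint uniformly convex if for every $t\in(0,1)$, $\tilde\delta_X(t):=\inf_{x\in S_X}\sup_{Z\in\mathrm{cof}(X)}\inf_{z\in S_Z}\max\{\|x+tz\|,\|x-tz\|\}-1>0$, where $\mathrm{cof}(X)$ is the set of (closed) finite-codimensional subspaces of $X$ and $S_Z$ the unit sphere of $Z$. *)

(* Defs.v *)
From HB Require Import structures.
From mathcomp Require Import all_boot all_order all_algebra.
From mathcomp Require Import all_classical all_reals all_analysis.
From mathcomp Require Import measurable_realfun ring_quotient.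

Set Implicit Arguments.
Unset Strict Implicit.
Unset Printing Implicit Defensive.
Import Order.TTheory GRing.Theory Num.Theory.
Import numFieldNormedType.Exports.

Local Open Scope classical_set_scope.
Local Open Scope ring_scope.

Section strong_measurability.
Context d (T : measurableType d) (R : realType) (Y : normedModType R).
Implicit Types s f g : T -> Y.

Definition simple_function s :=
  finite_set (range s) /\ forall y, measurable (s @^-1` [set y]).

(* The limit is everywhere; allowing almost everywhere limits would enlarge the
   set of functions, but not their classes modulo equality almost everywhere. *)
Definition strongly_measurable f :=
  exists s : nat -> T -> Y, (forall n, simple_function (s n)) /\
    forall x, s n x @[n --> \oo] --> f x.

Lemma simple_function_preimage s (A : set Y) :
  simple_function s -> measurable (s @^-1` A).
Proof.
move=> [fs ms].
rewrite (_ : s @^-1` A = \bigcup_(y in range s `&` A) s @^-1` [set y]).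
  by apply: fin_bigcup_measurable => //; exact: finite_setIl.
apply/seteqP; split=> [x Ax|x [y [_ Ay]] /= ->//].
by exists (s x) => //; split => //; exists x.
Qed.

Lemma simple_function_comp2 (Z : normedModType R) (h : Y -> Z -> Y) s (t : T -> Z) :
  finite_set (range s) -> finite_set (range t) ->
  (forall y, measurable (s @^-1` [set y])) ->
  (forall z, measurable (t @^-1` [set z])) ->
  simple_function (fun x => h (s x) (t x)).
Proof.
move=> fs ft ms mt; split.
  apply: (@sub_finite_set _ _ ((fun yz => h yz.1 yz.2) @` (range s `*` range t))).
    by move=> _ [x _ <-]; exists (s x, t x) => //; split; exists x.
  by apply: finite_image; exact: finite_setX.
move=> y.
rewrite (_ : _ @^-1` _ = \bigcup_(w in range s) \bigcup_(z in range t `&` [set z | h w z = y])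
    (s @^-1` [set w] `&` t @^-1` [set z])).
  apply: fin_bigcup_measurable => // w _.
  apply: fin_bigcup_measurable; first exact: finite_setIl.
  by move=> z _; exact: measurableI.
apply/seteqP; split=> [x /= <-|x [w _] [z [_ /= <-]] /= [-> ->]//].
by exists (s x); [exists x | exists (t x); [split => //; exists x|]].
Qed.

Lemma strongly_measurable_norm f : strongly_measurable f ->
  measurable_fun setT (fun x => `|f x|).
Proof.
move=> [s [ss sf]].
apply: (@measurable_fun_cvg _ _ _ _ (fun n x => `|s n x|)).
  move=> n _ A mA; rewrite setTI.
  exact: (@simple_function_preimage (s n) (Num.norm @^-1` A)).
by move=> x _; apply: cvg_norm; exact: sf.
Qed.

Lemma strongly_measurable0 : strongly_measurable (0 : T -> Y).
Proof.
exists (fun _ => 0); split=> [_|x]; last exact: cvg_cst.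
split.
  by apply: (@sub_finite_set _ _ [set 0]) => // _ [x _ <-].
by move=> y; rewrite [X in measurable X](preimage_cst (0 : Y)); case: ifP.
Qed.

Lemma strongly_measurableD f g :
  strongly_measurable f -> strongly_measurable g -> strongly_measurable (f + g).
Proof.
move=> [s [ss sf]] [t [tt tg]].
exists (fun n x => s n x + t n x); split=> [n|x]; last by apply: cvgD.
have [[? ?] [? ?]] := (ss n, tt n).
exact: (@simple_function_comp2 _ (fun y z => y + z)).
Qed.

Lemma strongly_measurableZ (a : R) f :
  strongly_measurable f -> strongly_measurable (a *: f).
Proof.
move=> [s [ss sf]].
exists (fun n x => a *: s n x); split=> [n|x]; last by apply: cvgZr.
have [? ?] := ss n.
exact: (@simple_function_comp2 _ (fun y _ => a *: y) (s n) (s n)).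
Qed.

End strong_measurability.

Section bochner_function.
Context d (T : measurableType d) (R : realType).
Variables (mu : {measure set T -> \bar R}) (Y : normedModType R).
Variables (p : R) (p1 : 1 <= p).
Implicit Types f g : T -> Y.

Definition bochner_Lnorm f : \bar R := Lnorm mu p%:E (fun x => `|f x|%:E).

(* The unused proof argument keeps [p1] inferable from [bochner_fun] below. *)
Definition bochner_pred (_ : 1 <= p) : {pred T -> Y} :=
  [pred f | `[< strongly_measurable f /\ (bochner_Lnorm f < +oo)%E >]].

Let p0 : 0 < p. Proof. exact: lt_le_trans p1. Qed.

Lemma bochner_LnormE f :
  bochner_Lnorm f = ((\int[mu]_x (`|f x| `^ p)%:E) `^ p^-1)%E.
Proof.
rewrite /bochner_Lnorm unlock; congr (_ `^ _)%E; apply: eq_integral => x _ /=.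
by rewrite normr_id.
Qed.

Lemma bochner_LnormD f g : strongly_measurable f -> strongly_measurable g ->
  (bochner_Lnorm (f + g)%R <= bochner_Lnorm f + bochner_Lnorm g)%E.
Proof.
move=> mf mg.
have mnf := strongly_measurable_norm mf.
have mng := strongly_measurable_norm mg.
have mnfg := strongly_measurable_norm (strongly_measurableD mf mg).
apply: le_trans (minkowski_EFin mu mnf mng p1).
rewrite bochner_LnormE unlock /=; apply: gt0_ler_poweR;
  rewrite ?in_itv/= ?leey ?andbT ?integral_ge0//.
- by rewrite invr_ge0 ltW.
apply: ge0_le_integral => //.
- apply/measurable_EFinP.
  exact: (@measurableT_comp _ _ _ _ _ _ (@powR R ^~ p)).
- apply/measurable_EFinP.
  apply: (@measurableT_comp _ _ _ _ _ _ (@powR R ^~ p)) => //.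
  by apply: measurableT_comp => //; exact: measurable_funD.
move=> x _; rewrite lee_fin ge0_ler_powR ?nnegrE ?(ltW p0)//.
by rewrite [leRHS]ger0_norm ?addr_ge0// ler_normD.
Qed.

Lemma bochner_LnormZ (a : R) f : strongly_measurable f ->
  (bochner_Lnorm (a *: f)%R = `|a|%:E * bochner_Lnorm f)%E.
Proof.
move=> mf; rewrite !bochner_LnormE.
under eq_integral do rewrite /= normrZ powRM// EFinM.
rewrite ge0_integralZl_EFin ?powR_ge0//; last first.
  apply/measurable_EFinP.
  apply: (@measurableT_comp _ _ _ _ _ _ (@powR R ^~ p)) => //.
  exact: strongly_measurable_norm.
rewrite poweRM ?lee_fin ?powR_ge0 ?integral_ge0//.
by rewrite poweR_EFin -powRrM mulfV ?gt_eqF// powRr1.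
Qed.

Lemma bochner_Lnorm_ae f g : strongly_measurable f -> strongly_measurable g ->
  {ae mu, forall x, f x = g x} -> bochner_Lnorm f = bochner_Lnorm g.
Proof.
move=> mf mg fg; rewrite !bochner_LnormE; congr (_ `^ _)%E.
apply: ge0_ae_eq_integral => //.
- apply/measurable_EFinP.
  apply: (@measurableT_comp _ _ _ _ _ _ (@powR R ^~ p)) => //.
  exact: strongly_measurable_norm.
- apply/measurable_EFinP.
  apply: (@measurableT_comp _ _ _ _ _ _ (@powR R ^~ p)) => //.
  exact: strongly_measurable_norm.
- by apply: filterS fg => x /= ->.
Qed.

Lemma bochner_Lnorm_eq0 f : strongly_measurable f ->
  bochner_Lnorm f = 0%E -> {ae mu, forall x, f x = 0}.
Proof.
move=> mf /Lnorm_eq0_eq0 h.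
have : {ae mu, forall x, setT x -> `|f x|%:E = 0%E}.
  by apply: h; [apply/measurable_EFinP/strongly_measurable_norm|rewrite lte_fin].
by apply: filterS => x /(_ I) [] /normr0_eq0.
Qed.

Lemma bochner_submod_closed : submod_closed (bochner_pred p1).
Proof.
split.
  apply/asboolP; split; first exact: strongly_measurable0.
  rewrite -(scale0r (0 : T -> Y)) bochner_LnormZ ?normr0 ?mul0e//.
  exact: strongly_measurable0.
move=> a f g /asboolP[mf nf] /asboolP[mg ng]; apply/asboolP; split.
  exact: strongly_measurableD (strongly_measurableZ a mf) mg.
apply: le_lt_trans (bochner_LnormD (strongly_measurableZ a mf) mg) _.
by rewrite bochner_LnormZ// lte_add_pinfty// lte_mul_pinfty ?lee_fin.
Qed.

HB.instance Definition _ :=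
  GRing.isSubmodClosed.Build R (T -> Y) (bochner_pred p1) bochner_submod_closed.

Record bochner_fun := BochnerFun {
  bochner_val :> T -> Y ;
  bochner_valP : bochner_val \in bochner_pred p1 }.

HB.instance Definition _ := [isSub for bochner_val].
HB.instance Definition _ := [Choice of bochner_fun by <:].
HB.instance Definition _ := [SubChoice_isSubLmodule of bochner_fun by <:].

Lemma bochner_fun_measurable (f : bochner_fun) : strongly_measurable f.
Proof. by have /asboolP[] := bochner_valP f. Qed.

Lemma bochner_fun_fin_num (f : bochner_fun) : bochner_Lnorm f \is a fin_num.
Proof. by have /asboolP[_ ?] := bochner_valP f; rewrite ge0_fin_numE// Lnorm_ge0. Qed.

Definition bochner_null : {pred bochner_fun} :=
  [pred f : bochner_fun | `[< {ae mu, forall x, f x = 0} >]].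

Lemma bochner_null_zmod_closed : zmod_closed bochner_null.
Proof.
split; first by apply/asboolP; apply/nearW.
move=> f g /asboolP f0 /asboolP g0; apply/asboolP.
by apply: filterS2 f0 g0 => x fx gx; rewrite -[LHS]/(f x - g x) fx gx subr0.
Qed.

HB.instance Definition _ :=
  GRing.isZmodClosed.Build bochner_fun bochner_null bochner_null_zmod_closed.

End bochner_function.
Arguments bochner_null {d T R} mu Y {p} p1.

Section bochner_space.
Context d (T : measurableType d) (R : realType).
Variables (mu : {measure set T -> \bar R}) (Y : normedModType R).
Variables (p : R) (p1 : 1 <= p).

(* L_p(mu; Y): p-integrable functions modulo equality almost everywhere. *)
Definition bochner_space : Type := {ideal_quot (bochner_null mu Y p1)}.

HB.instance Definition _ := GRing.Zmodule.on bochner_space.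
HB.instance Definition _ := EqQuotient.on bochner_space.

Local Notation class f := (\pi_bochner_space f)%qT.

Lemma bochner_spaceP (f g : bochner_fun mu Y p1) :
  class f = class g <-> {ae mu, forall x, f x = g x}.
Proof.
split=> [/eqP|fg].
  rewrite -Quotient.idealrBE => /asboolP; apply: filterS => x.
  by rewrite -[LHS]/(f x - g x) => /eqP; rewrite subr_eq0 => /eqP.
apply/eqP; rewrite -Quotient.idealrBE; apply/asboolP; apply: filterS fg => x fg.
by rewrite -[LHS]/(f x - g x) fg subrr.
Qed.

Lemma bochner_piD (f g : bochner_fun mu Y p1) : class (f + g) = class f + class g.
Proof. exact: (Quotient.pi_add (bochner_null mu Y p1)). Qed.

Lemma bochner_pi0 : class 0 = 0.
Proof. by apply: (addrI (class 0)); rewrite -bochner_piD !addr0. Qed.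

Definition bochner_scale (a : R) (u : bochner_space) : bochner_space :=
  class (a *: repr u).

Lemma bochner_repr_ae (f : bochner_fun mu Y p1) :
  {ae mu, forall x, repr (class f) x = f x}.
Proof. by apply/bochner_spaceP; rewrite reprK. Qed.

Lemma bochner_piZ a (f : bochner_fun mu Y p1) :
  class (a *: f) = bochner_scale a (class f).
Proof.
apply/bochner_spaceP; apply: filterS (bochner_repr_ae f) => x fx.
by rewrite -[LHS]/(a *: f x) -[RHS]/(a *: repr (class f) x) fx.
Qed.

Lemma bochner_scalerA a b u :
  bochner_scale a (bochner_scale b u) = bochner_scale (a * b) u.
Proof. by rewrite -[u]reprK -(bochner_piZ b) -!bochner_piZ scalerA. Qed.

Lemma bochner_scale1r : left_id 1 bochner_scale.
Proof. by move=> u; rewrite -[u in LHS]reprK -bochner_piZ scale1r reprK. Qed.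

Lemma bochner_scalerDr : right_distributive bochner_scale +%R.
Proof.
move=> a u v; rewrite -[u]reprK -[v]reprK.
by rewrite -bochner_piD -!bochner_piZ -bochner_piD scalerDr.
Qed.

Lemma bochner_scalerDl u : {morph bochner_scale^~ u : a b / a + b}.
Proof.
by move=> a b; rewrite -[u]reprK -!bochner_piZ -bochner_piD scalerDl.
Qed.

HB.instance Definition _ := GRing.Zmodule_isLmodule.Build R bochner_space
  bochner_scalerA bochner_scale1r bochner_scalerDr bochner_scalerDl.

Definition bochner_norm (u : bochner_space) : R := fine (bochner_Lnorm mu p (repr u)).

Lemma bochner_normE (f : bochner_fun mu Y p1) :
  bochner_norm (class f) = fine (bochner_Lnorm mu p f).
Proof.
congr fine; apply: (@bochner_Lnorm_ae _ _ _ mu Y p); try exact: bochner_fun_measurable.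
exact: bochner_repr_ae.
Qed.

Lemma ler_bochner_normD u v :
  bochner_norm (u + v) <= bochner_norm u + bochner_norm v.
Proof.
rewrite -[u]reprK -[v]reprK -bochner_piD !bochner_normE.
rewrite -lee_fin EFinD !fineK ?bochner_fun_fin_num//.
by apply: (@bochner_LnormD _ _ _ mu Y p p1); exact: bochner_fun_measurable.
Qed.

Lemma bochner_normZ a u : bochner_norm (a *: u) = `|a| * bochner_norm u.
Proof.
rewrite -[u]reprK -[_ *: _]bochner_piZ !bochner_normE.
apply: EFin_inj; rewrite EFinM !fineK ?bochner_fun_fin_num//.
by apply: (@bochner_LnormZ _ _ _ mu Y p p1); exact: bochner_fun_measurable.
Qed.

Lemma bochner_norm_eq0 u : bochner_norm u = 0 -> u = 0.
Proof.
move=> nu0; have := fineK (bochner_fun_fin_num (repr u)).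
rewrite -/(bochner_norm u) nu0 => /esym u0.
rewrite -[u]reprK -bochner_pi0; apply/bochner_spaceP.
exact: (bochner_Lnorm_eq0 p1 (bochner_fun_measurable _) u0).
Qed.

HB.instance Definition _ := Lmodule_isNormed.Build R bochner_space
  ler_bochner_normD bochner_normZ bochner_norm_eq0.

End bochner_space.
Arguments bochner_space {d T R} mu Y {p} p1.


Section asymptotic_midpoint_uniform_convexity.
Context (R : realType) (X : normedModType R).
Implicit Types Z : set X.

Definition unit_sphere : set X := [set x | `|x| = 1].

Definition linear_subspace Z :=
  Z 0 /\ forall (a : R) x y, Z x -> Z y -> Z (a *: x + y).

(* X / Z is spanned by the classes of finitely many vectors. *)
Definition finite_codim Z := exists (n : nat) (v : 'I_n -> X),
  forall x, exists a : 'I_n -> R, Z (x - \sum_(i < n) a i *: v i).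

Definition cof : set (set X) :=
  [set Z | [/\ linear_subspace Z, closed Z & finite_codim Z]].

(* In \bar R the infimum over an empty sphere is +oo, as intended when X or Z
   is trivial; in R it would be 0. *)
Definition amuc_modulus (t : R) : \bar R :=
  (ereal_inf [set ereal_sup
     [set ereal_inf [set (Num.max `|x + t *: z|%R `|x - t *: z|%R)%:E
                    | z in Z `&` unit_sphere]
     | Z in cof]
   | x in unit_sphere] - 1%:E)%E.

Definition amuc := forall t : R, 0 < t -> t < 1 -> (0 < amuc_modulus t)%E.

Definition uniformly_convex := forall e : R, 0 < e -> e <= 2 ->
  exists2 delta : R, 0 < delta &
    forall x y, unit_sphere x -> unit_sphere y -> e <= `|x - y| ->
      `|2^-1 *: (x + y)| <= 1 - delta.

End asymptotic_midpoint_uniform_convexity.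
Arguments amuc {R} X.
Arguments uniformly_convex {R} X.

Record equiv_norm (R : realType) (X : normedModType R) := EquivNorm {
  equiv_norm_fun :> X -> R ;
  equiv_normD : forall x y,
    equiv_norm_fun (x + y) <= equiv_norm_fun x + equiv_norm_fun y ;
  equiv_normZ : forall (a : R) x,
    equiv_norm_fun (a *: x) = `|a| * equiv_norm_fun x ;
  equiv_norm_bounds : exists c C : R, [/\ 0 < c, 0 < C &
    forall x, c * `|x| <= equiv_norm_fun x <= C * `|x|] }.

(* The vector space X with the norm N in place of its own. *)
Definition renormed (R : realType) (X : normedModType R) (N : equiv_norm X) : Type := X.

Section renormed.
Context (R : realType) (X : normedModType R) (N : equiv_norm X).

HB.instance Definition _ := GRing.Lmodule.on (renormed N).

Lemma equiv_norm_eq0 (x : renormed N) : N x = 0 -> x = 0.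
Proof.
have [c [C [c0 _ /(_ x)/andP[cN _]]]] := equiv_norm_bounds N.
move=> Nx0; move: cN; rewrite Nx0 pmulr_rle0// normr_le0 => /eqP; exact.
Qed.

HB.instance Definition _ := Lmodule_isNormed.Build R (renormed N)
  (@equiv_normD R X N) (@equiv_normZ R X N) equiv_norm_eq0.

End renormed.

Definition admits_equiv_norm (R : realType) (P : normedModType R -> Prop)
  (X : normedModType R) := exists N : equiv_norm X, P (renormed N).

(* Lebesgue measure on [0, 1], as a measure on the Borel sets of R carried by
   `[0, 1]; bochner_space thus ignores the values of functions elsewhere. *)
Definition lebesgue01 (R : realType) : {measure set (measurableTypeR R) -> \bar R} :=
  mrestr lebesgue_measure (measurable_itv `[0%R, 1%R]).

(* Main.v *)
Require Import Defs.
From mathcomp Require Import all_boot all_order all_algebra.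
From mathcomp Require Import all_classical all_reals all_analysis.
From mathcomp Require Import measurable_realfun ring_quotient.
From mathcomp Require Import ring lra.
Import Order.TTheory GRing.Theory Num.Theory.
Import numFieldNormedType.Exports.
Set Implicit Arguments.
Unset Strict Implicit.
Unset Printing Implicit Defensive.
Local Open Scope ring_scope.

(** Given an asymptotically midpoint uniformly convex norm on L_p([0,1], Y), a
    Y-valued dyadic martingale with values in a ball is realised by dyadic step
    functions, the signs of each increment being chosen so that the increment is
    close to a prescribed finite-codimensional subspace.  The norm then grows by
    a fixed amount at every step where a fixed proportion of the increments has
    norm at least eps.  Hence the expected number of increments of norm at least
    eps is bounded, uniformly over all such martingales.  The supremum G y of a
    weighted version of this number over the martingales starting at y is bounded
    and uniformly midpoint concave, and the gauge of the set of all y with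
    |y| + (G 0 - G y) / 2 <= 1 is an equivalent uniformly convex norm on Y.
    Conversely, a uniformly convex norm on Y satisfies a pointwise inequality
    between |u + v|^p, |u - v|^p, |u|^p and |v|^p which integrates to a uniform
    midpoint inequality in L_p([0,1], Y). *)

(** * Linear systems whose solutions are signs up to a few coordinates *)

Section saturation.
Context (R : realFieldType).

(** More than [n] rows of length [n] are linearly dependent; the coefficients of a dependency among
    the rows in [U] are extended by zero. *)
Lemma supported_kernel_vector (K n : nat) (A : 'M[R]_(K, n)) (U : {set 'I_K}) :
  (n < #|U|)%N -> exists b : 'rV[R]_K,
    [/\ b *m A = 0, b != 0 & forall i, i \notin U -> b 0 i = 0].
Proof.
move=> nU; pose f (k : 'I_#|U|) : 'I_K := enum_val k.
have : kermx (rowsub f A) != 0.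
  rewrite kermx_eq0 -row_leq_rank -ltnNge; exact: leq_ltn_trans (rank_leq_col _) nU.
rewrite -nz_row_eq0; set c := nz_row _ => c0.
have cA : c *m rowsub f A = 0 by apply/sub_kermxP; exact: nz_row_sub.
have bE i : (c *m rowsub f 1%:M) 0 i = \sum_k c 0 k * (f k == i)%:R.
  by rewrite mxE; apply: eq_bigr => k _; rewrite !mxE.
exists (c *m rowsub f 1%:M); split.
- by rewrite -mulmxA mul_rowsub_mx mul1mx.
- apply: contraNneq c0 => b0; apply/eqP/rowP => k; rewrite mxE.
  have := bE (f k); rewrite b0 mxE (bigD1 k)//= eqxx mulr1 big1 ?addr0// => k' kk'.
  by rewrite (inj_eq enum_val_inj) (negPf kk') mulr0.
move=> i iU; rewrite bE big1// => k _; case: eqP => [ki|]; last by rewrite mulr0.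
by rewrite -ki enum_valP in iU.
Qed.

(* Start from 0 and move inside the kernel, along a direction supported by the
   unsaturated coordinates, until one more coordinate reaches 1 or -1. *)
Lemma exists_saturated (K n : nat) (A : 'M[R]_(K, n)) : exists a : 'rV[R]_K,
  [/\ a *m A = 0, forall i, `|a 0 i| <= 1 & (#|[set i | (`|a 0 i| != 1)%R]| <= n)%N].
Proof.
suff main m (a : 'rV[R]_K) : a *m A = 0 -> (forall i, `|a 0 i| <= 1) ->
    (#|[set i | (`|a 0 i| != 1)%R]| <= m)%N -> exists a : 'rV[R]_K,
    [/\ a *m A = 0, forall i, `|a 0 i| <= 1 & (#|[set i | (`|a 0 i| != 1)%R]| <= n)%N].
  apply: (main K 0); first by rewrite mul0mx.
    by move=> i; rewrite mxE normr0.
  by rewrite -[leqRHS]card_ord max_card.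
elim: m a => [|m IH] a aA a1 am.
  by exists a; split=> //; exact: leq_trans am _.
have [an|na] := leqP #|[set i | (`|a 0 i| != 1)%R]| n; first by exists a.
have [b [bA b0 bU]] := supported_kernel_vector A na.
have /existsP[i0 bi0] : [exists i, b 0 i != 0].
  apply: contraNT b0 => /existsPn bz; apply/eqP/rowP => i; rewrite mxE.
  by have := bz i; rewrite negbK => /eqP.
(* [q i] is the time at which coordinate [i], moving from [a] with velocity [b], reaches the sign of
   [b 0 i]. At the smallest of these times no coordinate has left [[-1, 1]] and a new one is
   saturated; those saturated before do not move. *)
pose q i := (1 - Num.sg (b 0 i) * a 0 i) / `|b 0 i|.
case: (@arg_minP _ _ _ i0 (fun i => b 0 i != 0) q bi0) => i bi qmin.
have sga j : `|Num.sg (b 0 j) * a 0 j| <= 1.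
  by rewrite normrM normr_sg; case: (_ != 0); rewrite ?mul1r ?mul0r// ler01.
have q0 : 0 <= q i.
  by apply: divr_ge0 => //; have := sga i; rewrite ler_norml; lra.
have e1 j : `|(a + q i *: b) 0 j| <= 1.
  rewrite !mxE; have [bj|bj] := eqVneq (b 0 j) 0; first by rewrite bj mulr0 addr0.
  have -> : `|a 0 j + q i * b 0 j| = `|Num.sg (b 0 j) * a 0 j + q i * `|b 0 j| |.
    rewrite (normrEsg (b 0 j)) mulrCA -mulrDr normrM.
    by rewrite normr_sg bj mul1r.
  have b0j : 0 < `|b 0 j| by rewrite normr_gt0.
  have := qmin j bj; rewrite {2}/q ler_pdivlMr// => qj.
  have := sga j; rewrite !ler_norml => /andP[? ?].
  by have := mulr_ge0 q0 (ltW b0j); lra.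
apply: (IH (a + q i *: b)) => //.
  by rewrite mulmxDl -scalemxAl aA bA scaler0 addr0.
rewrite -ltnS; apply: leq_trans am; apply: proper_card.
apply/properP; split.
  apply/fintype.subsetP => j; rewrite !inE; apply: contraNneq => aj.
  by rewrite !mxE bU ?mulr0 ?addr0 ?aj// inE aj eqxx.
exists i; first by apply: contraNT bi => /bU ->.
rewrite inE negbK !mxE /q.
have sb : Num.sg (b 0 i) * Num.sg (b 0 i) = 1 by rewrite -expr2 sqr_sg bi.
suff -> : a 0 i + (1 - Num.sg (b 0 i) * a 0 i) / `|b 0 i| * b 0 i = Num.sg (b 0 i).
  by rewrite normr_sg bi.
rewrite [X in _ * X](numEsg (b 0 i)) mulrA mulrAC divfK ?normr_eq0//.
by rewrite mulrBl mul1r mulrAC sb mul1r addrC subrK.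
Qed.

End saturation.

Local Open Scope classical_set_scope.

Lemma norm_le_midpoint (R : realType) (X : normedModType R) (u v : X) :
  `|u| <= (`|u + v| + `|u - v|) / 2.
Proof.
have := ler_normD (u + v) (u - v).
by rewrite addrACA subrr addr0 -mulr2n normrMn mulr2n; lra.
Qed.

(** * A uniformly convex norm from a bounded uniformly concave function *)

Section gauge.
Context (R : realType) (Y : normedModType R).
Variables (G : Y -> R) (w : R -> R).
Hypothesis G01 : forall y, 0 <= G y <= 1.
Hypothesis GN : forall y, G (- y) = G y.
Hypothesis Gout : forall y, 3 < `|y| -> G y = 0.
Hypothesis Gmid : forall x y, `|x| <= 3 -> `|y| <= 3 ->
  (G x + G y) / 2 + w `|x - y| <= G (2^-1 *: (x + y)).
Hypothesis w0 : forall s, 0 <= w s.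
Hypothesis w_gt0 : forall e, 0 < e -> exists2 w0, 0 < w0 & forall s, e <= s -> w0 <= w s.

(** The added term lies between 0 and 1/2, because [G] takes its maximum at 0. Thus [H] stays close
    to the norm, and the uniform concavity of [G] becomes uniform midpoint convexity on the ball of
    radius 3. *)
Let H y := `|y| + (G 0 - G y) / 2.

(** [G] is even and 0 is the midpoint of [y] and [- y]. *)
Lemma G_le0 y : G y <= G 0.
Proof.
have [y3|y3] := leP `|y| 3; last by rewrite Gout //; case/andP: (G01 0).
have := @Gmid y (- y) y3; rewrite normrN GN subrr scaler0 => /(_ y3).
by have := w0 `|y - - y|; lra.
Qed.

Lemma norm_le_H y : `|y| <= H y.
Proof. by rewrite /H; have := G_le0 y; lra. Qed.

Lemma H_le y : H y <= `|y| + 2^-1.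
Proof. by rewrite /H; have := G01 y; have := G01 0; lra. Qed.

Lemma H0 : H 0 = 0. Proof. by rewrite /H normr0 subrr mul0r addr0. Qed.

Lemma HN y : H (- y) = H y. Proof. by rewrite /H normrN GN. Qed.

Lemma H_mid x y : `|x| <= 3 -> `|y| <= 3 ->
  H (2^-1 *: (x + y)) <= (H x + H y) / 2 - w `|x - y| / 2.
Proof.
move=> x3 y3; rewrite /H normrZ gtr0_norm ?invr_gt0//.
by have := Gmid x3 y3; have := ler_normD x y; lra.
Qed.

Lemma norm_conv (x y : Y) (l r : R) : `|x| <= r -> `|y| <= r -> 0 <= l -> l <= 1 ->
  `|l *: x + (1 - l) *: y| <= r.
Proof.
move=> xr yr l0 l1; apply: le_trans (ler_normD _ _) _.
rewrite !normrZ !ger0_norm ?subr_ge0//; nra.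
Qed.

(* The supremum S of the convexity defect satisfies S <= S / 2, since each
   point of a segment is the midpoint of an endpoint and another point of it. *)
Lemma H_convex x y (l : R) : `|x| <= 3 -> `|y| <= 3 -> 0 <= l -> l <= 1 ->
  H (l *: x + (1 - l) *: y) <= l * H x + (1 - l) * H y.
Proof.
move=> x3 y3.
pose D (l : R) := H (l *: x + (1 - l) *: y) - (l * H x + (1 - l) * H y).
suff DS : forall l, 0 <= l -> l <= 1 -> D l <= 0.
  by move=> l0 l1; have := DS l l0 l1; rewrite /D; lra.
pose A := [set D l | l in [set l | 0 <= l <= 1]].
have supA : has_sup A.
  split; first by exists (D 0), 0 => //=; lra.
  exists (3 + 2^-1) => _ [m /= m01 <-]; rewrite /D.
  have := H_le (m *: x + (1 - m) *: y).
  have := @norm_conv x y m 3 x3 y3; have := norm_le_H x; have := norm_le_H y.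
  have := normr_ge0 x; have := normr_ge0 y; nra.
have D_le l' : 0 <= l' -> l' <= 1 -> D l' <= sup A.
  by move=> ? ?; apply: ub_le_sup; [case: supA|exists l' => //=; lra].
have D2 l' : 0 <= l' -> l' <= 1 -> D l' <= sup A / 2.
  move=> l0 l1; have [l2|l2] := leP l' 2^-1.
    have -> : D l' = D (2 * l' / 2) by congr D; field.
    have n3 : `|(2 * l') *: x + (1 - 2 * l') *: y| <= 3 by apply: norm_conv => //; lra.
    have := H_mid n3 y3; have := @D_le (2 * l'); rewrite /D.
    have -> : 2^-1 *: ((2 * l') *: x + (1 - 2 * l') *: y + y) =
        (2 * l' / 2) *: x + (1 - 2 * l' / 2) *: y.
      rewrite -addrA -{2}(scale1r y) -scalerDl scalerDr !scalerA.
      by congr (_ *: _ + _ *: _); field.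
    by have := w0 `|(2 * l') *: x + (1 - 2 * l') *: y - y|; lra.
  pose m := 2 * l' - 1.
  have -> : D l' = D ((m + 1) / 2) by congr D; rewrite /m; field.
  have m0 : 0 <= m by rewrite /m; lra.
  have m1 : m <= 1 by rewrite /m; lra.
  have n3 : `|m *: x + (1 - m) *: y| <= 3 by apply: norm_conv.
  have := H_mid n3 x3; have := D_le _ m0 m1; rewrite /D.
  have -> : 2^-1 *: (m *: x + (1 - m) *: y + x) =
      ((m + 1) / 2) *: x + (1 - (m + 1) / 2) *: y.
    rewrite addrAC -{2}(scale1r x) -scalerDl scalerDr !scalerA.
    by congr (_ *: _ + _ *: _); field.
  by have := w0 `|m *: x + (1 - m) *: y - x|; lra.
have : sup A <= sup A / 2.
  apply: ge_sup; first by case: supA.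
  by move=> _ [m /= /andP[m0 m1] <-]; exact: D2.
by move=> ? l' l0 l1; have := D_le _ l0 l1; lra.
Qed.

(** The sublevel set [H <= 1] lies between the balls of radius 1/2 and 1; hence the constants 1 and
    2 that compare its Minkowski functional [gauge] with the norm. *)
Let adm y : set R := [set l | 0 < l /\ H (l^-1 *: y) <= 1].
Let gauge y := inf (adm y).

Lemma adm_norm_le y l : adm y l -> `|y| <= l.
Proof.
move=> [l0 /(le_trans (norm_le_H _))].
by rewrite normrZ gtr0_norm ?invr_gt0// mulrC ler_pdivrMr// mul1r.
Qed.

Lemma adm_norm1 y l : adm y l -> `|l^-1 *: y| <= 1.
Proof. by move=> [l0 /(le_trans (norm_le_H _))]. Qed.

Lemma adm_2norm y l : 2 * `|y| <= l -> 0 < l -> adm y l.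
Proof.
move=> yl l0; split => //; apply: le_trans (H_le _) _.
rewrite normrZ gtr0_norm ?invr_gt0//.
suff : l^-1 * `|y| <= 2^-1 by lra.
by rewrite mulrC ler_pdivrMr//; lra.
Qed.

Lemma adm_neq0 y : adm y !=set0.
Proof. by exists (2 * `|y| + 1); apply: adm_2norm; have := normr_ge0 y; lra. Qed.

Lemma adm_lb y : has_lbound (adm y).
Proof. by exists `|y| => l; exact: adm_norm_le. Qed.

Lemma gauge_le y l : adm y l -> gauge y <= l.
Proof. by move=> yl; apply: ge_inf => //; exact: adm_lb. Qed.

Lemma gauge_ge y m : (forall l, adm y l -> m <= l) -> m <= gauge y.
Proof. by move=> h; apply: lb_le_inf => //; exact: adm_neq0. Qed.

(** The quotient of [x + y] by [l + m] is the convex combination of [x / l] and [y / m] with weights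
    [l / (l + m)] and [m / (l + m)], so convexity of [H] applies. *)
Lemma admD x y l m : adm x l -> adm y m -> adm (x + y) (l + m).
Proof.
move=> xl ym; have [[l0 Hx] [m0 Hy]] := (xl, ym).
have x1 := adm_norm1 xl; have y1 := adm_norm1 ym.
have lm0 : 0 < l + m by exact: addr_gt0.
split=> //.
have -> : (l + m)^-1 *: (x + y) =
    (l / (l + m)) *: (l^-1 *: x) + (1 - l / (l + m)) *: (m^-1 *: y).
  rewrite scalerDr !scalerA; congr (_ *: _ + _ *: _); field.
    by rewrite !gt_eqF.
  by rewrite !gt_eqF.
have k0 : 0 <= l / (l + m) by rewrite divr_ge0// ltW.
have k1 : l / (l + m) <= 1 by rewrite ler_pdivrMr//; lra.
apply: le_trans (H_convex _ _ k0 k1) _; [lra..|]; nra.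
Qed.

Lemma adm_le x l m : adm x l -> l <= m -> adm x m.
Proof.
move=> xl; rewrite le_eqVlt => /predU1P[<-//|lm].
rewrite -(subrK l m) addrC -(addr0 x); apply: admD => //.
by split; rewrite ?subr_gt0// scaler0 H0.
Qed.

Lemma gauge_adm x l : gauge x < l -> adm x l.
Proof.
move=> /(inf_lt (adm_neq0 x))[m xm ml].
exact: adm_le xm (ltW ml).
Qed.

Lemma norm_le_gauge y : `|y| <= gauge y.
Proof. by apply: gauge_ge => l; exact: adm_norm_le. Qed.

Lemma gauge_le_norm y : gauge y <= 2 * `|y|.
Proof.
apply/ler_addgt0Pr => e e0; apply: gauge_le; apply: adm_2norm; first lra.
by have := normr_ge0 y; lra.
Qed.

Lemma gaugeD x y : gauge (x + y) <= gauge x + gauge y.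
Proof.
apply/ler_addgt0Pr => e e0.
have -> : gauge x + gauge y + e = (gauge x + e / 2) + (gauge y + e / 2) by field.
by apply: gauge_le; apply: admD; apply: gauge_adm; lra.
Qed.

Lemma admZ a x l : a != 0 -> adm x l -> adm (a *: x) (`|a| * l).
Proof.
move=> a0 [l0 Hx]; have na0 : 0 < `|a| by rewrite normr_gt0.
split; first exact: mulr_gt0.
rewrite scalerA; have [ap|an] := ltP 0 a.
  rewrite gtr0_norm// (_ : (a * l)^-1 * a = l^-1)//.
  by field; rewrite !gt_eqF.
rewrite ler0_norm// (_ : (- a * l)^-1 * a = - l^-1) ?scaleNr ?HN//.
by field; rewrite a0 gt_eqF.
Qed.

Lemma gaugeZ_le a x : a != 0 -> gauge (a *: x) <= `|a| * gauge x.
Proof.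
move=> a0; have na0 : 0 < `|a| by rewrite normr_gt0.
rewrite -ler_pdivrMl//; apply: gauge_ge => l xl.
by rewrite ler_pdivrMl//; apply: gauge_le; exact: admZ.
Qed.

Lemma gaugeZ a x : gauge (a *: x) = `|a| * gauge x.
Proof.
have [->|a0] := eqVneq a 0.
  rewrite normr0 mul0r scale0r; apply/eqP; rewrite eq_le.
  by have := gauge_le_norm 0; have := norm_le_gauge 0; rewrite normr0 mulr0 => -> ->.
apply/eqP; rewrite eq_le gaugeZ_le//=.
have := @gaugeZ_le a^-1 (a *: x); rewrite invr_eq0 scalerA mulVf// scale1r.
by move=> /(_ a0); rewrite normrV ?unitfE// mulrC ler_pdivlMr ?normr_gt0// mulrC.
Qed.

Lemma gauge_bounds : exists c C : R, [/\ 0 < c, 0 < C &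
    forall x : Y, c * `|x| <= gauge x <= C * `|x|].
Proof.
exists 1, 2; split=> // x.
by rewrite mul1r norm_le_gauge gauge_le_norm.
Qed.

Let N := EquivNorm gaugeD gaugeZ gauge_bounds.

(** If two points of the sublevel set are far apart, [H] is smaller than 1 by a fixed amount at
    their midpoint [v]. By convexity of [H] between [v] and [2 *: v], the point [(1 + s) *: v] is
    then still in the set, so the gauge of [v] is at most [(1 + s)^-1]. *)
Lemma gauge_uniformly_convex : admits_equiv_norm (@uniformly_convex R) Y.
Proof.
exists N => e e0 e2.
(* One factor 2 is lost from the gauge to the norm, the other in dividing by [l <= 2]. *)
have [|w1 w10 w1P] := @w_gt0 (e / 4); first exact: divr_gt0.
(* With [H (2 *: v) <= 3] and [H v <= 1 - w1 / 2], this choice gives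
   [s * 3 + (1 - s) * (1 - w1 / 2) <= 1]. *)
pose s := Num.min (w1 / 6) 6^-1.
have s0 : 0 < s by rewrite lt_min invr_gt0 ltr0n andbT divr_gt0.
have s1 : s <= 6^-1 by rewrite ge_min lexx orbT.
have sw : s <= w1 / 6 by rewrite ge_min lexx.
have s10 : 0 < 1 + s by rewrite addr_gt0.
exists (1 - (1 + s)^-1); first by rewrite subr_gt0 invf_lt1//; lra.
suff main (x y : Y) : gauge x = 1 -> gauge y = 1 -> e <= gauge (x - y) ->
    gauge (2^-1 *: (x + y)) <= 1 - (1 - (1 + s)^-1).
  by move=> x y; exact: main.
move=> x1 y1 exy.
rewrite (_ : 1 - (1 - _) = (1 + s)^-1); last ring.
rewrite -(@mul1r _ (1 + s)^-1) ler_pdivlMr//.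
(* The gauge is an infimum that need not be attained, so [x] and [y] are divided by [1 + t] with [t]
   arbitrarily small. *)
apply/ler_addgt0Pr => t'; pose t := Num.min t' 1 => t'0.
have tt' : t <= t' by rewrite ge_min lexx.
have t0 : 0 < t by rewrite lt_min t'0 ltr01.
have t1 : t <= 1 by rewrite ge_min lexx orbT.
suff : gauge (2^-1 *: (x + y)) * (1 + s) <= 1 + t by lra.
clearbody t; clear t' t'0 tt'.
pose l := 1 + t; have l0 : 0 < l by rewrite /l; lra.
have xl : adm x l by apply: gauge_adm; rewrite x1 /l; lra.
have yl : adm y l by apply: gauge_adm; rewrite y1 /l; lra.
have nx := adm_norm1 xl; have ny := adm_norm1 yl.
have [_ Hx] := xl; have [_ Hy] := yl.
have := @H_mid (l^-1 *: x) (l^-1 *: y) ltac:(lra) ltac:(lra).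
set v := 2^-1 *: _.
have v1 : `|v| <= 1.
  rewrite /v normrZ gtr0_norm ?invr_gt0//.
  by have := ler_normD (l^-1 *: x) (l^-1 *: y); lra.
have : w1 <= w `|l^-1 *: x - l^-1 *: y|.
  apply: w1P; rewrite -scalerBr normrZ gtr0_norm ?invr_gt0//.
  rewrite ler_pdivlMl//; have := le_trans exy (gauge_le_norm _).
  by rewrite /l; nra.
move=> ww Hv.
have v2 : `|2 *: v| <= 3 by rewrite normrZ gtr0_norm//; lra.
have Hv2 : H (2 *: v) <= 3.
  by apply: le_trans (H_le _) _; rewrite normrZ gtr0_norm//; lra.
have : H (s *: (2 *: v) + (1 - s) *: v) <= 1.
  apply: (le_trans (H_convex v2 _ (ltW s0) _)); [lra..|].
  have Hv' : H v <= 1 - w1 / 2 by lra.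
  have s1' : 0 <= 1 - s by lra.
  have := ler_wpM2l (ltW s0) Hv2; have := ler_wpM2l s1' Hv'; nra.
rewrite scalerA -scalerDl => Hsv.
have : adm (2^-1 *: (x + y)) (l / (1 + s)).
  split; first by rewrite divr_gt0.
  move: Hsv; rewrite /v -scalerDr !scalerA; congr (H (_ *: _) <= _).
  by field; rewrite !gt_eqF.
by move=> /gauge_le; rewrite ler_pdivlMr.
Qed.

End gauge.

(** * Dyadic martingales as binary trees, and the concave function they define *)

Inductive tree (Y : Type) := Leaf of Y | Node of tree Y & tree Y.

Section trees.
Context (R : realType) (Y : normedModType R).
Implicit Types (t : tree Y) (w : R -> R).

Fixpoint tmean t : Y :=
  match t with Leaf y => y | Node t1 t2 => 2^-1 *: (tmean t1 + tmean t2) end.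

Fixpoint in_ball r t : Prop :=
  match t with Leaf y => `|y| <= r | Node t1 t2 => in_ball r t1 /\ in_ball r t2 end.

(* The mean over a random branch of the sum of [w] at the gaps it meets; a tree
   is a finite dyadic martingale, started at [tmean t]. *)
Fixpoint cnt w t : R :=
  match t with
  | Leaf _ => 0
  | Node t1 t2 => (cnt w t1 + cnt w t2) / 2 + w `|tmean t1 - tmean t2|
  end.

Fixpoint topp t : tree Y :=
  match t with Leaf y => Leaf (- y) | Node t1 t2 => Node (topp t1) (topp t2) end.

Lemma tmean_in_ball r t : in_ball r t -> `|tmean t| <= r.
Proof.
elim: t => [//|t1 IH1 t2 IH2] /= [/IH1 h1 /IH2 h2].
rewrite normrZ gtr0_norm ?invr_gt0//.
by have := ler_normD (tmean t1) (tmean t2); lra.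
Qed.

Lemma tmean_opp t : tmean (topp t) = - tmean t.
Proof. by elim: t => //= t1 -> t2 ->; rewrite -opprD scalerN. Qed.

Lemma in_ball_opp r t : in_ball r t -> in_ball r (topp t).
Proof.
by elim: t => [y|t1 IH1 t2 IH2] /=; rewrite ?normrN// => -[/IH1 ? /IH2].
Qed.

Lemma cnt_opp w t : cnt w (topp t) = cnt w t.
Proof. by elim: t => //= t1 -> t2 ->; rewrite !tmean_opp -opprD normrN. Qed.

(** Joining a tree with mean [x] and one with mean [y] under a new node gives a tree at their
    midpoint, with [w] of the gap added to the average of the counts. Hence the supremum of [cnt w]
    over trees of given mean is uniformly midpoint concave; negating the leaves shows that it is
    even. *)
Lemma uniformly_convex_of_cnt_le1 w : (forall s, 0 <= w s) ->
  (forall e, 0 < e -> exists2 w0, 0 < w0 & forall s, e <= s -> w0 <= w s) ->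
  (forall t, in_ball 3 t -> cnt w t <= 1) ->
  admits_equiv_norm (@uniformly_convex R) Y.
Proof.
move=> w0 w_gt0 w1.
pose A (y : Y) := [set cnt w t | t in [set t | tmean t = y /\ in_ball 3 t]].
have ubA y : has_ubound (A y) by exists 1 => _ [t /= [_ /w1 ?] <-].
have A0 y : `|y| <= 3 -> A y !=set0 by move=> y3; exists 0, (Leaf y).
(* No tree in the ball has such a mean, and [sup] of the empty set is 0, as [Gout] requires. *)
have Aout y : 3 < `|y| -> A y = set0.
  move=> y3; rewrite -subset0 => r [t /= [ty t3] _].
  by have := tmean_in_ball t3; rewrite ty leNgt y3.
pose G y := sup (A y).
have leG t : in_ball 3 t -> cnt w t <= G (tmean t).
  by move=> t3; apply: ub_le_sup => //; exists t.
apply: (@gauge_uniformly_convex R Y G w) => //.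
- move=> y; have [y3|y3] := leP `|y| 3; last by rewrite /G Aout// sup0 lexx ler01.
  apply/andP; split; first exact: (@leG (Leaf y)).
  by apply: ge_sup; [exact: A0|move=> _ [t /= [_ /w1 ?] <-]].
- move=> y; congr sup; apply/seteqP; split=> _ [t /= [ty t3] <-].
    exists (topp t); last exact: cnt_opp.
    by rewrite /= tmean_opp ty opprK; split=> //; exact: in_ball_opp.
  exists (topp t); last exact: cnt_opp.
  by rewrite /= tmean_opp ty; split=> //; exact: in_ball_opp.
- by move=> y y3; rewrite /G Aout// sup0.
move=> x y x3 y3.
suff : G x <= 2 * (G (2^-1 *: (x + y)) - w `|x - y|) - G y by lra.
apply: ge_sup; first exact: A0.
move=> _ [t /= [tx t3] <-].
suff : G y <= 2 * (G (2^-1 *: (x + y)) - w `|x - y|) - cnt w t by lra.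
apply: ge_sup; first exact: A0.
move=> _ [u /= [uy u3] <-].
have := @leG (Node t u) (conj t3 u3); rewrite /= tx uy; lra.
Qed.

(** The thresholds [1 / (k + 1)] are merged into one weight [w], dominated by a series of their
    indicators whose coefficients are small enough for the total count to be at most 1. *)
Lemma uniformly_convex_of_bounded_cnt :
  (forall e : R, 0 < e -> exists K, forall t, in_ball 3 t ->
    cnt (fun s => (e <= s)%R%:R) t <= K) ->
  admits_equiv_norm (@uniformly_convex R) Y.
Proof.
move=> cntK.
pose e k : R := k.+1%:R^-1; pose i k s : R := (e k <= s)%R%:R.
have /choice[K KP] (k : nat) : exists K, 1 <= K /\
    forall t, in_ball 3 t -> cnt (i k) t <= K.
  have [|K KP] := cntK (e k); first by rewrite invr_gt0.
  by exists (Num.max 1 K); split=> [|t /KP h]; rewrite le_max ?lexx// h orbT.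
(* Partial sums of the bounds, rather than the bounds themselves, make [a] nonincreasing, so that
   [w] is bounded below away from 0. *)
pose L k := \sum_(j < k.+1) K j.
have L1 k : 1 <= L k.
  elim: k => [|k IH]; rewrite /L big_ord_recr /=.
    by rewrite big_ord0 add0r; case: (KP 0%N).
  by rewrite (le_trans IH)// lerDl; have [] := KP k.+1; lra.
have L0 k : 0 < L k by apply: lt_le_trans (L1 k).
pose a k := 2^-1 ^+ k.+1 / L k.
have a0 k : 0 < a k by rewrite divr_gt0// exprn_gt0.
have aS k : a k.+1 <= a k.
  apply: ler_pM; rewrite ?invr_ge0 ?exprn_ge0 ?(ltW (L0 _))//.
    by rewrite exprS ler_piMl ?exprn_ge0//; lra.
  rewrite lef_pV2 ?posrE// /L [leRHS]big_ord_recr /= lerDl.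
  by have [] := KP k.+1; lra.
have a_homo m n : (m <= n)%N -> a n <= a m.
  by move=> /subnK <-; elim: (n - m)%N => // k IH; exact: le_trans (aS _) IH.
(* For [s > 0] and [k] the integer part of [s^-1] one has [e k < s], so the indicator [i k] is 1 at
   [s] and its term alone dominates [w s]. *)
pose w (s : R) := if s <= 0 then 0 else a (Num.truncn s^-1).
have w0 s : 0 <= w s by rewrite /w; case: ifP => // _; exact: ltW.
apply: (@uniformly_convex_of_cnt_le1 w) => //.
  move=> d d0; exists (a (Num.truncn d^-1)) => // s ds.
  have s0 := lt_le_trans d0 ds.
  rewrite /w (leNgt s) s0 /=; apply: a_homo; apply: le_truncn.
  by rewrite lef_pV2.
have wi s m : (Num.truncn s^-1 < m)%N -> w s <= \sum_(k < m) a k * i k s.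
  move=> sm; rewrite /w; case: (leP s 0) => s0.
    by apply: sumr_ge0 => k _; rewrite mulr_ge0// ?(ltW (a0 _))// ler0n.
  have ei : e (Num.truncn s^-1) <= s.
    by rewrite /e -[leRHS]invrK lef_pV2 ?posrE ?invr_gt0// ltW// truncnS_gt.
  rewrite (bigD1 (Ordinal sm))//= /i ei mulr1.
  by rewrite lerDl sumr_ge0 // => k _; rewrite mulr_ge0// ?(ltW (a0 _))// ler0n.
(* A tree has finitely many gaps, so finitely many thresholds suffice, their number depending on the
   tree. *)
have cnt_le t : exists M, forall m, (M <= m)%N ->
    cnt w t <= \sum_(k < m) a k * cnt (i k) t.
  elim: t => [y|t1 [M1 IH1] t2 [M2 IH2]].
    by exists 0%N => m _ /=; rewrite big1// => k _; rewrite mulr0.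
  pose s := `|tmean t1 - tmean t2|.
  exists (maxn M1 (maxn M2 (Num.truncn s^-1).+1)) => m; rewrite !geq_max.
  move=> /and3P[/IH1 h1 /IH2 h2 /wi h3] /=; rewrite -/s.
  apply: le_trans (_ : _ <= (\sum_(k < m) a k * cnt (i k) t1 +
    \sum_(k < m) a k * cnt (i k) t2) / 2 + \sum_(k < m) a k * i k s) _; first lra.
  rewrite -big_split mulr_suml -big_split /=; apply: ler_sum => k _.
  by rewrite le_eqVlt; apply/orP; left; apply/eqP; field.
move=> t t3; have [M /(_ M (leqnn M)) tM] := cnt_le t.
apply: le_trans tM _.
apply: le_trans (_ : _ <= \sum_(k < M) 2^-1 ^+ k.+1) _.
  apply: ler_sum => k _; rewrite /a mulrAC ler_pdivrMr// ler_wpM2l ?exprn_ge0//.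
  have [K1 /(_ t t3)] := KP k; move/le_trans; apply.
  rewrite /L big_ord_recr /= lerDr; apply: sumr_ge0 => j _.
  by have [] := KP j; lra.
suff -> : \sum_(k < M) 2^-1 ^+ k.+1 = 1 - 2^-1 ^+ M :> R.
  by rewrite gerBl exprn_ge0.
elim: M => [|M IH]; first by rewrite big_ord0 expr0 subrr.
by rewrite big_ord_recr /= IH exprS; field.
Qed.

End trees.

(** * Growth of an asymptotically midpoint uniformly convex norm along dyadic martingales *)

Section avg.
Context (R : realType).
Implicit Types F : nat -> R.

Definition avg n F : R := 2^-1 ^+ n * \sum_(i < 2 ^ n) F i.

Lemma avg_half n F :
  avg n.+1 F = avg n (fun i => (F i.*2 + F i.*2.+1) / 2).
Proof.
have dbl N : \sum_(i < N.*2) F i = \sum_(i < N) (F i.*2 + F i.*2.+1).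
  by elim: N => [|N IH]; rewrite ?big_ord0// doubleS !big_ord_recr /= IH addrA.
by rewrite /avg expnS mul2n dbl exprS -mulr_suml -mulrA mulrCA (mulrC 2^-1).
Qed.

Lemma avg_le n F G : (forall i, (i < 2 ^ n)%N -> F i <= G i) -> avg n F <= avg n G.
Proof. by move=> FG; rewrite ler_wpM2l ?exprn_ge0//; apply: ler_sum => i _; exact: FG. Qed.

Lemma eq_avg n F G : (forall i, (i < 2 ^ n)%N -> F i = G i) -> avg n F = avg n G.
Proof. by move=> FG; congr (_ * _); apply: eq_bigr => i _; exact: FG. Qed.

(** Halving an index gives the parent dyadic interval, so [iter k half] goes back [k] generations
    and takes each value below [2 ^ n] on [2 ^ k] indices. *)
Lemma avg_shift n k F : avg (n + k) (fun i => F (iter k half i)) = avg n F.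
Proof.
elim: k => [|k IH]; first by rewrite addn0.
rewrite addnS avg_half -IH; apply: eq_avg => i _.
by rewrite !iterSr /= doubleK uphalf_double; field.
Qed.

Lemma avgZ n a F : avg n (fun i => a * F i) = a * avg n F.
Proof. by rewrite /avg -mulr_sumr mulrCA. Qed.

Lemma avg_cst n (a : R) : avg n (fun=> a) = a.
Proof.
rewrite /avg sumr_const card_ord -[a *+ _]mulr_natl mulrA natrX -exprMn.
by rewrite mulVf// expr1n mul1r.
Qed.

End avg.

(** * The gain of norm at one point of an asymptotically midpoint uniformly convex space *)

Section amuc_local.
Context (R : realType) (X : normedModType R).

Lemma amuc_subspace : amuc X -> forall t : R, 0 < t -> t < 1 ->
  exists2 delta, 0 < delta & forall x : X, `|x| = 1 ->
    exists Z : set X, [/\ linear_subspace Z, finite_codim Z &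
      forall z, Z z -> `|z| = 1 -> 1 + delta <= Num.max `|x + t *: z| `|x - t *: z|].
Proof.
move=> h t t0 t1; have := h t t0 t1; rewrite /amuc_modulus.
set S := [set ereal_sup _ | x in _] => S1.
have [d d0 dS] : exists2 d : R, 0 < d & ((1 + d)%:E < ereal_inf S)%E.
  (* The value [+oo] does occur, for instance in finite dimension, where the zero subspace has an
     empty sphere; any gain will then do. *)
  case: (ereal_inf S) S1 => [r| |] //=.
    rewrite -EFinB lte_fin => r1; exists ((r - 1) / 2); first by rewrite divr_gt0.
    by rewrite lte_fin; lra.
  by move=> _; exists 1 => //; rewrite ltry.
exists d => // x x1.
have /(lt_le_trans dS) : (ereal_inf S <= ereal_sup
     [set ereal_inf [set (Num.max `|x + t *: z|%R `|x - t *: z|%R)%:E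
                    | z in Z `&` @unit_sphere R X]
     | Z in @cof R X])%E by apply: ereal_inf_lbound; exists x.
move=> /ereal_sup_gt[_ [Z [Zlin _ Zcodim] <-]] dZ.
exists Z; split => // z Zz z1; rewrite -lee_fin ltW//.
by apply: (lt_le_trans dZ); apply: ereal_inf_lbound; exists z.
Qed.

Lemma norm_le_max (x w : X) : `|x| <= Num.max `|x + w| `|x - w|.
Proof.
have := norm_le_midpoint x w; rewrite le_max.
by case: (leP `|x + w| `|x - w|) => ? ?; apply/orP; [right|left]; lra.
Qed.

Lemma norm_le_max_r (x w : X) : `|w| <= Num.max `|x + w| `|x - w|.
Proof. by rewrite [x + w]addrC [`|x - w|]distrC; exact: norm_le_max. Qed.

(** Both [x + l *: w] and [x - l *: w] are convex combinations of [x + w] and [x - w], with weights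
    [(1 + l) / 2] and [(1 - l) / 2]. *)
Lemma max_norm_mono (x w : X) (l : R) : 0 <= l -> l <= 1 ->
  Num.max `|x + l *: w| `|x - l *: w| <= Num.max `|x + w| `|x - w|.
Proof.
move=> l0 l1; pose m := Num.max `|x + w| `|x - w|; rewrite -/m.
have xp : `|x + w| <= m by rewrite le_max lexx.
have xm : `|x - w| <= m by rewrite le_max lexx orbT.
have conv (a b : X) (r : R) : 0 <= r -> r <= 1 -> `|a| <= m -> `|b| <= m ->
    `|r *: a + (1 - r) *: b| <= m.
  move=> r0 r1 am bm; apply: le_trans (ler_normD _ _) _.
  by rewrite !normrZ !ger0_norm ?subr_ge0//; nra.
rewrite ge_max; apply/andP; split.
  have := @conv (x + w) (x - w) ((1 + l) / 2) ltac:(lra) ltac:(lra) xp xm.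
  congr (`|_| <= _); rewrite scalerDr scalerBr addrACA -scalerDl -scalerBl.
  by congr (_ + _ *: _); [rewrite -[RHS]scale1r; congr (_ *: _)|]; field.
have := @conv (x + w) (x - w) ((1 - l) / 2) ltac:(lra) ltac:(lra) xp xm.
congr (`|_| <= _); rewrite scalerDr scalerBr addrACA -scalerDl -scalerBl -(scaleNr l).
by congr (_ + _ *: _); [rewrite -[RHS]scale1r; congr (_ *: _)|]; field.
Qed.

(* Small [x] gain because [w] itself is large; for large [x] the definition
   applies to [x / `|x|] and to the multiple of [z] of norm [t]. *)
Lemma amuc_gain (beta alpha : R) : amuc X -> 0 < beta -> 0 < alpha ->
  exists2 eta, 0 < eta & forall x : X, `|x| <= beta ->
    exists Z : set X, [/\ linear_subspace Z, finite_codim Z &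
      forall w z, Z z -> `|w - z| <= eta -> alpha <= `|w| ->
        `|x| + eta <= Num.max `|x + w| `|x - w|].
Proof.
move=> hX b0 a0.
(* This gives [t * |x| <= alpha / 2 <= |z|], so the multiple [l *: z] of norm [t * |x|] has [l <= 1]
   and [max_norm_mono] applies. *)
pose t := Num.min 2^-1 (alpha / (2 * beta)).
have t0 : 0 < t by rewrite lt_min invr_gt0 ltr0n divr_gt0// mulr_gt0.
have t1 : t < 1 by rewrite gt_min; apply/orP; left; lra.
have tb : t * (2 * beta) <= alpha.
  by rewrite -ler_pdivlMr ?mulr_gt0// ge_min lexx orbT.
have [d d0 dP] := amuc_subspace hX t0 t1.
(* The first bound keeps [|z| >= alpha / 2]. The second makes the gain [d * |x|] at least [2 * eta],
   of which one [eta] is lost in passing from [z] to [w]. *)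
pose eta := Num.min (alpha / 2) (d * alpha / 4).
have eta0 : 0 < eta by rewrite lt_min !divr_gt0// mulr_gt0.
have eta1 : eta <= alpha / 2 by rewrite ge_min lexx.
have eta2 : eta <= d * alpha / 4 by rewrite ge_min lexx orbT.
exists eta => // x xb.
have [xa|ax] := ltP `|x| (alpha / 2).
  exists setT; split => //; first by exists 0%N, (fun=> 0) => y; exists (fun=> 0).
  by move=> w z _ _ wa; apply: le_trans (norm_le_max_r _ _); lra.
have x0 : 0 < `|x| by lra.
have x1 : `| `|x|^-1 *: x| = 1 by rewrite normrZ ger0_norm ?invr_ge0// mulVf// gt_eqF.
have [Z [Zlin Zc ZP]] := dP _ x1.
exists Z; split => // w z Zz wz wa.
have z_ge : alpha / 2 <= `|z|.
  by have := ler_normD (w - z) z; rewrite subrK; lra.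
have z0 : 0 < `|z| by lra.
pose l := t * `|x| / `|z|.
have l0 : 0 <= l by rewrite divr_ge0// mulr_ge0// ltW.
have l1 : l <= 1.
  by rewrite ler_pdivrMr// mul1r; have := ler_wpM2l (ltW t0) xb; lra.
have Zu : Z (`|z|^-1 *: z).
  by case: Zlin => Z0 /(_ `|z|^-1 z 0 Zz Z0); rewrite addr0.
have u1 : `| `|z|^-1 *: z| = 1 by rewrite normrZ ger0_norm ?invr_ge0// mulVf// gt_eqF.
have := ZP _ Zu u1.
have e1 : `| `|x|^-1 *: x + t *: (`|z|^-1 *: z)| = `|x|^-1 * `|x + l *: z|.
  rewrite -[X in X * _]ger0_norm ?invr_ge0// -normrZ scalerDr !scalerA.
  by congr (`|_ + _ *: _|); rewrite /l; field; rewrite !gt_eqF.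
have e2 : `| `|x|^-1 *: x - t *: (`|z|^-1 *: z)| = `|x|^-1 * `|x - l *: z|.
  rewrite -[X in X * _]ger0_norm ?invr_ge0// -normrZ scalerBr !scalerA.
  by congr (`|_ - _ *: _|); rewrite /l; field; rewrite !gt_eqF.
rewrite e1 e2 -maxr_pMr ?invr_ge0// => h.
have {}h : `|x| * (1 + d) <= Num.max `|x + l *: z| `|x - l *: z|.
  by rewrite -ler_pdivlMl.
have {}h := le_trans h (max_norm_mono x z l0 l1).
have zw1 : `|x + z| <= `|x + w| + eta.
  have := ler_normD (x + w) (z - w); rewrite addrA [x + w + z]addrAC addrK.
  by rewrite (distrC z); lra.
have zw2 : `|x - z| <= `|x - w| + eta.
  have := ler_normD (x - w) (w - z); rewrite addrA subrK; lra.
have : Num.max `|x + z| `|x - z| <= Num.max `|x + w| `|x - w| + eta.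
  by rewrite ge_max; apply/andP; split;
    [apply: le_trans zw1 _|apply: le_trans zw2 _]; rewrite lerD2r le_max lexx ?orbT.
have := ler_wpM2r (ltW d0) ax; lra.
Qed.

End amuc_local.

(** * Dyadic increments with signs chosen near a finite-codimensional subspace *)

Section dyadic.
Context (R : realType) (Y X : normedModType R) (p c C : R).
Variable E : nat -> (nat -> Y) -> X.

(** This is the norm in L_p of the step function equal to [f i] on the [i]-th dyadic interval of
    length [2 ^- n]; [E n f] stands for that function as an element of [X]. *)
Definition pav n (f : nat -> Y) : R := avg n (fun i => `|f i| `^ p) `^ p^-1.

Hypothesis p_gt0 : 0 < p.
Hypothesis C_gt0 : 0 < C.
Hypothesis E_lin : forall n (a : R) f g,
  E n (fun i => a *: f i + g i) = a *: E n f + E n g.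
Hypothesis E_half : forall n f, E n.+1 (fun i => f i./2) = E n f.
Hypothesis E_bound : forall n f, c * pav n f <= `|E n f| <= C * pav n f.

Lemma E_cst0 n : E n (fun=> 0) = 0.
Proof.
have := E_lin n (-1) (fun=> 0) (fun=> 0); rewrite scaler0 addr0 => ->.
by rewrite scaleN1r addNr.
Qed.

Lemma pav_le n f (D : R) : 0 <= D -> avg n (fun i => `|f i| `^ p) <= D `^ p -> pav n f <= D.
Proof.
move=> D0 h; rewrite /pav -[leRHS](powRr1 D0) -(mulfV (lt0r_neq0 p_gt0)) powRrM.
apply: ge0_ler_powR; rewrite ?nnegrE ?powR_ge0 ?invr_ge0 ?(ltW p_gt0)//.
by rewrite mulr_ge0 ?exprn_ge0// sumr_ge0// => i _; exact: powR_ge0.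
Qed.

Lemma pav_ball n f (D : R) : (forall i, `|f i| <= D) -> pav n f <= D.
Proof.
move=> fD; have D0 : 0 <= D by apply: le_trans (fD 0%N).
apply: pav_le => //; rewrite -[leRHS](avg_cst n); apply: avg_le => i _.
by apply: ge0_ler_powR; rewrite ?nnegrE ?(ltW p_gt0).
Qed.

(** The difference has [pav] equal to 0, so the upper bound in [E_bound] annihilates its image. *)
Lemma E_ext n f g : (forall i, (i < 2 ^ n)%N -> f i = g i) -> E n f = E n g.
Proof.
move=> fg; apply/eqP; rewrite -subr_eq0 -normr_le0 addrC -scaleN1r -E_lin.
have /andP[_] := E_bound n (fun i => -1 *: g i + f i); move/le_trans; apply.
rewrite pmulr_rle0//; apply: pav_le => //.
rewrite -[leRHS](avg_cst n); apply: avg_le => i /fg ->.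
by rewrite scaleN1r addNr normr0.
Qed.

Lemma E_sum n K (a : 'I_K -> R) (f : 'I_K -> nat -> Y) :
  E n (fun i => \sum_j a j *: f j i) = \sum_j a j *: E n (f j).
Proof.
elim: K a f => [|K IH] a f.
  by rewrite big_ord0 -[RHS](E_cst0 n); apply: E_ext => i _; rewrite big_ord0.
rewrite big_ord_recl -IH -E_lin; apply: E_ext => i _; exact: big_ord_recl.
Qed.

Lemma E_shift n k f : E (n + k) (fun i => f (iter k half i)) = E n f.
Proof.
elim: k f => [|k IH] f; first by rewrite addn0.
by rewrite addnS -IH -[RHS]E_half; apply: E_ext => i _; rewrite iterSr.
Qed.

(** A combination of the Haar functions of generation [n] with coefficients [g], where [h] tells on
    which intervals the sign is reversed. *)
Definition flip n (h : nat -> bool) (g : nat -> Y) : X :=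
  E n.+1 (fun i => (-1) ^+ (odd i (+) h i./2) *: g i./2).

Lemma flipN n h g : flip n (fun i => ~~ h i) g = - flip n h g.
Proof.
rewrite /flip -[RHS]scaleN1r -[RHS]addr0 -(E_cst0 n.+1) -E_lin; apply: E_ext => i _.
by rewrite addbN addr0 signrN scaleN1r scaleNr.
Qed.

Lemma flip_ge n h g : c * pav n g <= `|flip n h g|.
Proof.
have /andP[+ _] := E_bound n.+1 (fun i => (-1) ^+ (odd i (+) h i./2) *: g i./2).
congr (c * (_ `^ _) <= _); rewrite avg_half; apply: eq_avg => i _.
by rewrite /= uphalf_double doubleK !normrZ !normr_sign !mul1r; field.
Qed.

Lemma small_inv_expn (r : R) : 0 < r -> exists k, 2^-1 ^+ k <= r.
Proof.
move=> r0; exists (Num.truncn r^-1).+1; rewrite exprVn -[leRHS]invrK.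
rewrite lef_pV2 ?posrE ?exprn_gt0 ?invr_gt0//.
apply: le_trans (ltW (truncnS_gt _)) _; rewrite -natrX ler_nat.
by apply: ltnW; exact: ltn_expl.
Qed.

(* The functions supported by one dyadic interval of length 2 ^- (n + k) span
   a space of dimension 2 ^ (n + k), so [exists_saturated] yields coefficients
   of a combination in [Z], all but a fixed number of which are signs. *)
Lemma near_flip n g (Z : set X) (kappa : R) : 0 < kappa ->
  (exists D, forall i, `|g i| <= D) -> linear_subspace Z -> finite_codim Z ->
  exists k h z, Z z /\ `|flip (n + k) h (fun i => g (iter k half i)) - z| <= kappa.
Proof.
move=> kappa0 [D gD] [Z0 Zlin] [m [v Zv]].
have D0 : 0 <= D by apply: le_trans (gD 0%N).
(* At most [m] coefficients will fail to be signs. On their intervals, of total length at most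
   [m * 2 ^- (n + k)], the error has norm at most [2 * D], and elsewhere it vanishes. *)
have [k kP] : exists k, 2^-1 ^+ (n + k) * (m%:R * (2 * D) `^ p) <= (kappa / C) `^ p.
  have [k kP] := @small_inv_expn ((kappa / C) `^ p / (m%:R * (2 * D) `^ p + 1))
    (divr_gt0 (powR_gt0 _ (divr_gt0 kappa0 C_gt0))
      (ltr_wpDl (mulr_ge0 (ler0n _ _) (powR_ge0 _ _)) ltr01)).
  exists k; move: kP; rewrite ler_pdivlMr; last first.
    exact: (ltr_wpDl (mulr_ge0 (ler0n _ _) (powR_ge0 _ _)) ltr01).
  apply: le_trans; apply: ler_pM => //; rewrite ?mulr_ge0 ?exprn_ge0 ?powR_ge0//.
    by rewrite exprD ler_piMl ?exprn_ge0// exprn_ile1 //; lra.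
  by rewrite lerDl.
pose K := (2 ^ (n + k))%N; pose G i := g (iter k half i).
pose b (j : 'I_K) i : Y := (j == i./2 :> nat)%:R *: ((-1) ^+ odd i *: G i./2).
have /choice[A AP] (j : 'I_K) : exists A : 'I_m -> R,
  Z (E (n + k).+1 (b j) - \sum_i A i *: v i) by exact: Zv.
have [a [aA a1 asat]] := exists_saturated (\matrix_(j, i) A j i).
pose al (i : nat) : R := if insub i is Some j then a 0 (j : 'I_K) else 0.
have alE (j : 'I_K) : al j = a 0 j by rewrite /al insubT//= => lt; congr (a 0 _); exact: val_inj.
(* Where the coefficient is 1 or -1, it equals [(-1) ^+ h i], so the flip agrees there with the
   combination lying in [Z]. *)
pose h i := al i == -1.
exists k, h, (\sum_j a 0 j *: E (n + k).+1 (b j)); split.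
  (* As [a] lies in the left kernel of [A], the components along [v] cancel and only elements of [Z]
     remain. *)
  have -> : \sum_j a 0 j *: E (n + k).+1 (b j) =
      \sum_j a 0 j *: (E (n + k).+1 (b j) - \sum_i A j i *: v i).
    under [RHS]eq_bigr do rewrite scalerBr scaler_sumr.
    rewrite sumrB [X in _ - X](_ : _ = 0) ?subr0// exchange_big big1//= => i _.
    under eq_bigr do rewrite scalerA.
    rewrite -scaler_suml; have /rowP/(_ i) := aA; rewrite [LHS]mxE [RHS]mxE => aA0.
    suff -> : \sum_j a 0 j * A j i = 0 by rewrite scale0r.
    by rewrite -[RHS]aA0; apply: eq_bigr => j _; rewrite mxE.
  elim/big_ind: _ => // [x y Zx Zy|j _].
    by rewrite -(scale1r x); exact: Zlin.
  by rewrite -[_ *: _]addr0; exact: Zlin.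
rewrite -E_sum -scaleN1r addrC -E_lin.
have /andP[_] := E_bound (n + k).+1 (fun i => -1 *: (\sum_j a 0 j *: b j i) +
  (-1) ^+ (odd i (+) h i./2) *: G i./2).
move/le_trans; apply; rewrite -ler_pdivlMl// mulrC; apply: pav_le.
  by rewrite divr_ge0 ?ltW.
apply: le_trans kP.
pose sat (j : nat) : bool := `|al j| != 1.
apply: (@le_trans _ _ (avg (n + k) (fun i => (sat i)%:R * (2 * D) `^ p))).
  have -> : avg (n + k) (fun i => (sat i)%:R * (2 * D) `^ p) =
      avg (n + k).+1 (fun i => (sat i./2)%:R * (2 * D) `^ p).
    rewrite avg_half; apply: eq_avg => i _.
    by rewrite /= uphalf_double doubleK; field.
  apply: avg_le => i iK.
  have iK' : (i./2 < K)%N by rewrite ltn_half_double -mul2n -expnS.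
  rewrite (bigD1 (Ordinal iK'))//= big1 ?addr0; last first.
    move=> j; rewrite /b -val_eqE /= => /negPf ->.
    by rewrite scale0r scaler0.
  rewrite /b eqxx scale1r -alE /= !scalerA -scalerDl normrZ.
  have -> : `|-1 * al i./2 * (-1) ^+ odd i + (-1) ^+ (odd i (+) h i./2)| =
      `|(-1) ^+ h i./2 - al i./2|.
    rewrite signr_addb -[RHS]mul1r -[X in X * `|_|](normr_sign R (odd i)) -normrM.
    by congr `|_|; rewrite mulN1r mulNr addrC mulrBr (mulrC (al _)).
  have [asat1|asat1] := boolP (sat i./2).
    rewrite mul1r; apply: ge0_ler_powR; rewrite ?nnegrE ?mulr_ge0 ?(ltW p_gt0)//.
    apply: ler_pM => //; last exact: gD.
    apply: le_trans (ler_normB _ _) _; rewrite normr_sign.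
    by have := a1 (Ordinal iK'); rewrite -alE /=; lra.
  suff -> : (-1) ^+ h i./2 - al i./2 = 0 by rewrite normr0 mul0r mul0r powR0// gt_eqF.
  move: asat1; rewrite /sat /h negbK eqr_norml ler01 andbT => /orP[/eqP ->|/eqP ->].
    by rewrite -subr_eq0 opprK (_ : 1 + 1 == 0 = false) ?subrr//; apply/eqP; lra.
  by rewrite eqxx subrr.
rewrite /avg -mulr_suml ler_wpM2l ?exprn_ge0// ler_wpM2r ?powR_ge0//.
move: asat; rewrite -(ler_nat R); apply: le_trans.
rewrite -sum1dep_card natr_sum [leRHS]big_mkcond /=; apply: ler_sum => j _.
by rewrite /sat alE; case: ifP.
Qed.

End dyadic.

(** * Counting the large increments along a branch *)

Section marks.
Context (R : realType) (Y : normedModType R).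
Variable eps : R.
Implicit Types t : tree Y.

Definition marked t1 t2 : bool := eps <= `|tmean t1 - tmean t2|.

(* The probability that a random branch of [t] has at least [j] marked nodes. *)
Fixpoint many t (j : nat) : R :=
  match t with
  | Leaf _ => (j == 0)%N%:R
  | Node t1 t2 =>
    if marked t1 t2 then
      if j is j'.+1 then (many t1 j' + many t2 j') / 2 else 1
    else (many t1 j + many t2 j) / 2
  end.

Lemma many0 t : many t 0 = 1.
Proof. by elim: t => //= t1 -> t2 ->; case: ifP => // _; field. Qed.

Lemma many_le1 t j : many t j <= 1.
Proof.
elim: t j => [y|t1 IH1 t2 IH2] j /=; first by case: (j == 0)%N.
by case: ifP => _; [case: j => // j; have := IH1 j; have := IH2 j
  |have := IH1 j; have := IH2 j]; lra.
Qed.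

Lemma many_decr t j : many t j.+1 <= many t j.
Proof.
elim: t j => [y|t1 IH1 t2 IH2] j /=; first exact: ler0n.
case: ifP => _; last by have := IH1 j; have := IH2 j; lra.
case: j => [|j]; last by have := IH1 j; have := IH2 j; lra.
by have := many_le1 t1 0; have := many_le1 t2 0; lra.
Qed.

Lemma many_le1S t j : many t j.+1 <= many t 1.
Proof. by elim: j => // j; apply: le_trans; exact: many_decr. Qed.

Fixpoint ht t : nat :=
  match t with Leaf _ => 0%N | Node t1 t2 => (maxn (ht t1) (ht t2)).+1 end.

(** The number of steps after which every branch has reached a marked node or a leaf for the first
    time. *)
Fixpoint unmarked_ht t : nat :=
  match t with
  | Leaf _ => 0%N
  | Node t1 t2 => if marked t1 t2 then 0%N else (maxn (unmarked_ht t1) (unmarked_ht t2)).+1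
  end.

Lemma unmarked_ht_le t : (unmarked_ht t <= ht t)%N.
Proof.
elim: t => //= t1 IH1 t2 IH2; case: ifP => // _; rewrite ltnS geq_max !leq_max.
by rewrite IH1 IH2 orbT.
Qed.

(** One step of a stopped martingale: it is frozen at marked nodes and leaves, whereas [step_marked]
    moves only at marked nodes. *)
Definition step_unmarked (b : bool) t :=
  if t is Node t1 t2 then if marked t1 t2 then t else if b then t2 else t1 else t.

Definition step_marked (b : bool) t :=
  if t is Node t1 t2 then if marked t1 t2 then if b then t2 else t1 else t else t.

Let cntm t := cnt (fun s => (eps <= s)%R%:R : R) t.

(* Cut each branch at its [j]-th marked node. *)
Lemma cnt_le_many (P : tree Y -> Prop) (L : R) n :
  (forall t1 t2, P (Node t1 t2) -> P t1 /\ P t2) ->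
  (forall t, P t -> (ht t <= n)%N -> cntm t <= L) -> 0 <= L ->
  forall t j, P t -> (ht t <= n.+1)%N -> (0 < j)%N -> cntm t <= j%:R + many t j * L.
Proof.
move=> PN PL L0 t j Pt tn j0.
(* Below the root the height is at most [n], so [j'] may drop to 0, where the bound [L] takes
   over. *)
have small t' j' : P t' -> (ht t' <= n)%N -> cntm t' <= j'%:R + many t' j' * L.
  elim: t' j' => [y|t1 IH1 t2 IH2] j' Pt' t'n.
    by rewrite /cntm /= addr_ge0 ?ler0n// mulr_ge0 ?ler0n.
  case: j' => [|j']; first by rewrite many0 mul1r add0r; exact: PL.
  have [P1 P2] := PN _ _ Pt'.
  move: t'n => /= t'n.
  have t1n : (ht t1 <= n)%N by apply: leq_trans (ltnW t'n); rewrite leq_maxl.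
  have t2n : (ht t2 <= n)%N by apply: leq_trans (ltnW t'n); rewrite leq_maxr.
  rewrite /cntm /= -/(marked t1 t2); case: (marked t1 t2); rewrite ?mulr1n ?mulr0n ?addr0.
    have := IH1 j' P1 t1n; have := IH2 j' P2 t2n.
    by rewrite /cntm -[j'.+1%:R]natr1; lra.
  have := IH1 j'.+1 P1 t1n; have := IH2 j'.+1 P2 t2n; rewrite /cntm; lra.
case: t Pt tn => [y|t1 t2] Pt; first by rewrite /cntm /= addr_ge0 ?ler0n// mulr_ge0 ?ler0n.
have [P1 P2] := PN _ _ Pt.
rewrite /= ltnS geq_max => /andP[t1n t2n].
case: j j0 => // j _.
rewrite /cntm /= -/(marked t1 t2); case: (marked t1 t2); rewrite ?mulr1n ?mulr0n ?addr0.
  have := small _ j P1 t1n; have := small _ j P2 t2n.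
  by rewrite /cntm -[j.+1%:R]natr1; lra.
have := small _ j.+1 P1 t1n; have := small _ j.+1 P2 t2n; rewrite /cntm; lra.
Qed.

(** By induction on the height: up to the mark number [m + 1] the count is at most [m + 1], and with
    probability at most 1/2 a lower tree remains. The bound is the solution of
    [L = (m + 1) + L / 2]. *)
Lemma cnt_bounded m r : (forall t, in_ball r t -> many t m.+1 <= 2^-1) ->
  forall t, in_ball r t -> cntm t <= 2 * m.+1%:R.
Proof.
move=> h t; move: {2}(ht t) (leqnn (ht t)) => n; elim: n t => [|n IH] t.
  by case: t => // y _ _; rewrite /cntm /= mulr_ge0 ?ler0n.
move=> tn tr.
have := @cnt_le_many (in_ball r) (2 * m.+1%:R) n _ _ _ t m.+1 tr tn isT.
move=> /(_ (fun t1 t2 h => h)) /(_ (fun t tr tn => IH t tn tr)).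
have m0 : 0 <= m.+1%:R :> R by exact: ler0n.
move=> /(_ (mulr_ge0 (ler0n _ _) m0)) /le_trans; apply.
have := ler_wpM2r m0 (h t tr); lra.
Qed.

End marks.

(** * Growth of the norm in rounds, one large increment per round *)

Section rounds.
Context (R : realType) (Y X : normedModType R) (p c C : R).
Variable E : nat -> (nat -> Y) -> X.
Hypothesis p_gt0 : 0 < p.
Hypothesis c_gt0 : 0 < c.
Hypothesis C_gt0 : 0 < C.
Hypothesis E_lin : forall n (a : R) f g,
  E n (fun i => a *: f i + g i) = a *: E n f + E n g.
Hypothesis E_half : forall n f, E n.+1 (fun i => f i./2) = E n f.
Hypothesis E_bound : forall n f, c * pav p n f <= `|E n f| <= C * pav p n f.
Hypothesis amucX : amuc X.
Variable eps : R.
Hypothesis eps_gt0 : 0 < eps.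
Implicit Types (t : tree Y) (tau : nat -> tree Y).

Notation many := (many eps).
Notation unmarked_ht := (unmarked_ht eps).

Let Ev n (tau : nat -> tree Y) := E n (fun i => tmean (tau i)).

Section step.
Variable step : bool -> tree Y -> tree Y.
Hypothesis tmean_step : forall t, tmean (step false t) + tmean (step true t) = 2 *: tmean t.

Definition half_gap t : Y := 2^-1 *: (tmean (step false t) - tmean (step true t)).

Lemma half_double (x : Y) : 2^-1 *: (x + x) = x.
Proof. by rewrite -mulr2n -(scaler_nat 2 x) scalerA mulVf// scale1r. Qed.

Lemma tmean_stepE b t : tmean (step b t) = tmean t + (-1) ^+ b *: half_gap t.
Proof.
have -> : tmean t = 2^-1 *: (tmean (step false t) + tmean (step true t)).
  by rewrite tmean_step scalerA mulVf// scale1r.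
rewrite /half_gap; case: b => /=; rewrite ?expr1 ?expr0 ?scaleN1r ?scale1r.
  by rewrite -scalerBr opprB addrACA [tmean (step true t) - _]addrC addrACA subrr add0r half_double.
by rewrite -scalerDr addrACA subrr addr0 half_double.
Qed.

Definition split h (tau : nat -> tree Y) i := step (odd i (+) h i./2) (tau i./2).

Lemma Ev_split n h tau :
  Ev n.+1 (split h tau) = Ev n tau + flip E n h (half_gap \o tau).
Proof.
rewrite /Ev -(E_half n) -[X in X + _]scale1r -E_lin.
by apply: (E_ext _ _ _ E_bound) => // i _; rewrite tmean_stepE scale1r.
Qed.

(** Subtracting the increment amounts to exchanging the two children on every interval, so the
    larger of the two norms is again that of a martingale step. *)
Lemma Ev_split_max n h tau : exists h',
  Num.max `|Ev n tau + flip E n h (half_gap \o tau)|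
    `|Ev n tau - flip E n h (half_gap \o tau)| = `|Ev n.+1 (split h' tau)|.
Proof.
case: (leP `|Ev n tau + flip E n h (half_gap \o tau)| `|Ev n tau - flip E n h (half_gap \o tau)|) => _.
  by exists (fun i => ~~ h i); rewrite Ev_split (flipN p_gt0 C_gt0 E_lin E_bound).
by exists h; rewrite Ev_split.
Qed.

Lemma avg_split n h tau (F : tree Y -> R) :
  avg n.+1 (fun i => F (split h tau i)) =
  avg n (fun i => (F (step false (tau i)) + F (step true (tau i))) / 2).
Proof.
rewrite avg_half; apply: eq_avg => i _.
rewrite /split /= odd_double uphalf_double doubleK /=.
by case: (h i) => //=; rewrite addrC.
Qed.

End step.

Lemma Ev_ge0_split step n tau :
  (forall t, tmean (step false t) + tmean (step true t) = 2 *: tmean t) ->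
  exists h, `|Ev n tau| <= `|Ev n.+1 (split step h tau)|.
Proof.
move=> /Ev_split_max/(_ n (fun=> false) tau)[h hE].
by exists h; rewrite -hE; exact: norm_le_max.
Qed.

Lemma tmean_step_unmarked t :
  tmean (step_unmarked eps false t) + tmean (step_unmarked eps true t) = 2 *: tmean t.
Proof.
case: t => [y|t1 t2] /=; first by rewrite -mulr2n scaler_nat.
case: ifP => _ /=; first by rewrite -mulr2n scaler_nat.
by rewrite scalerA mulfV// scale1r.
Qed.

Lemma tmean_step_marked t :
  tmean (step_marked eps false t) + tmean (step_marked eps true t) = 2 *: tmean t.
Proof.
case: t => [y|t1 t2] /=; first by rewrite -mulr2n scaler_nat.
case: ifP => _ /=; last by rewrite -mulr2n scaler_nat.
by rewrite scalerA mulfV// scale1r.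
Qed.

Lemma in_ball_step_unmarked b r t : in_ball r t -> in_ball r (step_unmarked eps b t).
Proof.
by case: t => //= t1 t2 tr; case: ifP => // _; case: b; case: tr.
Qed.

Lemma in_ball_step_marked b r t : in_ball r t -> in_ball r (step_marked eps b t).
Proof.
by case: t => //= t1 t2 tr; case: ifP => // _; case: b; case: tr.
Qed.

Lemma ht_step_unmarked b t : (ht (step_unmarked eps b t) <= ht t)%N.
Proof.
case: t => //= t1 t2; case: ifP => // _; case: b; apply: leqW;
  by rewrite leq_max leqnn ?orbT.
Qed.

Lemma ht_step_marked b t : (ht (step_marked eps b t) <= ht t)%N.
Proof.
case: t => //= t1 t2; case: ifP => // _; case: b; apply: leqW;
  by rewrite leq_max leqnn ?orbT.
Qed.

Lemma unmarked_ht_step b t : (unmarked_ht (step_unmarked eps b t) <= (unmarked_ht t).-1)%N.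
Proof.
case: t => //= t1 t2; case: ifP => [/= ->//|_]; case: b => /=;
  by rewrite leq_max leqnn ?orbT.
Qed.

Lemma many_step_unmarked t j :
  (many (step_unmarked eps false t) j + many (step_unmarked eps true t) j) / 2 = many t j.
Proof.
case: t => [y|t1 t2]; first by rewrite /=; field.
by rewrite /step_unmarked; case: ifP => mk; rewrite /= mk //; field.
Qed.

Lemma many_step_marked t j : unmarked_ht t = 0%N ->
  many t j.+1 <= (many (step_marked eps false t) j + many (step_marked eps true t) j) / 2.
Proof.
case: t => [y|t1 t2] /=; first by rewrite divr_ge0 ?addr_ge0 ?ler0n.
by case: ifP.
Qed.

Definition small_trees r M (tau : nat -> tree Y) :=
  forall i, in_ball r (tau i) /\ (ht (tau i) <= M)%N.

(** Unmarked nodes are passed with signs that keep the norm from decreasing; after at most [M] steps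
    all trees are frozen. No mark is passed, so the averages of [many] do not change. *)
Lemma unmarked_phase r M n tau : small_trees r M tau ->
  exists n' tau', [/\ small_trees r M tau', forall i, unmarked_ht (tau' i) = 0%N,
    `|Ev n tau| <= `|Ev n' tau'| &
    forall j, avg n' (fun i => many (tau' i) j) = avg n (fun i => many (tau i) j)].
Proof.
move=> tauM.
have : forall i, (unmarked_ht (tau i) <= M)%N.
  by move=> i; apply: leq_trans (unmarked_ht_le _ _) _; case: (tauM i).
elim: {2}M n tau tauM => [|m IH] n tau tauM um.
  by exists n, tau; split => // i; apply/eqP; rewrite -leqn0.
have [h hE] := Ev_ge0_split n tau tmean_step_unmarked.
have [||n' [tau' [tauM' um' le' eq']]] := IH n.+1 (split (step_unmarked eps) h tau).
- move=> i; have [? ?] := tauM i./2; split; first exact: in_ball_step_unmarked.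
  exact: leq_trans (ht_step_unmarked _ _) _.
- move=> i; apply: leq_trans (unmarked_ht_step _ _) _.
  by rewrite -ltnS; case: (unmarked_ht _) (um i./2).
exists n', tau'; split=> //; first exact: le_trans le'.
move=> j; rewrite eq' (avg_split (step_unmarked eps) n h tau (fun t => many t j)).
by apply: eq_avg => i _; exact: many_step_unmarked.
Qed.

(** Here [many t 1] is the indicator of a marked root, where the half gap is at least [eps / 2]. *)
Lemma marked_gap t : unmarked_ht t = 0%N ->
  (eps / 2) `^ p * many t 1 <= `|half_gap (step_marked eps) t| `^ p.
Proof.
case: t => [y|t1 t2] /=; first by rewrite mulr0 powR_ge0.
rewrite /half_gap /=; case: ifP => // mk _.
rewrite !many0 (_ : (1 + 1) / 2 = 1) ?mulr1; last by field.
apply: ge0_ler_powR; rewrite ?nnegrE ?divr_ge0 ?(ltW p_gt0) ?(ltW eps_gt0)//.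
by rewrite normrZ gtr0_norm ?invr_gt0// mulrC ler_wpM2l ?invr_ge0.
Qed.

Lemma half_gap_ball r step t : in_ball r (step false t) -> in_ball r (step true t) ->
  `|half_gap step t| <= r.
Proof.
move=> /tmean_in_ball h1 /tmean_in_ball h2.
rewrite normrZ gtr0_norm ?invr_gt0//.
by have := ler_normB (tmean (step false t)) (tmean (step true t)); lra.
Qed.

(** A proportion at least [s] of the trees has a marked root, which bounds the norm of the increment
    below by [alpha]. With signs bringing it within [eta] of the subspace given by [amuc_gain], the
    norm grows by [eta], which depends neither on the trees nor on [n]. *)
Lemma marked_phase r s : 0 < r -> 0 < s -> exists2 eta, 0 < eta &
  forall M n tau, small_trees r M tau -> (forall i, unmarked_ht (tau i) = 0%N) ->
    s <= avg n (fun i => many (tau i) 1) ->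
  exists n' tau', [/\ small_trees r M tau', `|Ev n tau| + eta <= `|Ev n' tau'| &
    forall j, avg n (fun i => many (tau i) j.+1) <= avg n' (fun i => many (tau' i) j)].
Proof.
move=> r0 s0.
pose alpha := c * ((eps / 2) `^ p * s) `^ p^-1.
have alpha0 : 0 < alpha by rewrite mulr_gt0// powR_gt0// mulr_gt0// powR_gt0// divr_gt0.
have [eta eta0 etaP] := amuc_gain amucX (mulr_gt0 C_gt0 r0) alpha0.
exists eta => // M n tau tauM um ns.
have tau_le : `|Ev n tau| <= C * r.
  have /andP[_] := E_bound n (fun i => tmean (tau i)); move/le_trans; apply.
  rewrite ler_pM2l//; apply: pav_ball => // i.
  by apply: tmean_in_ball; case: (tauM i).
have [Z [Zlin Zc ZP]] := etaP _ tau_le.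
pose g := half_gap (step_marked eps) \o tau.
have gD : exists D, forall i, `|g i| <= D.
  exists r => i; apply: half_gap_ball; apply: in_ball_step_marked; by case: (tauM i).
have [k [h [z [Zz zP]]]] :=
  near_flip p_gt0 C_gt0 E_lin E_bound n eta0 gD Zlin Zc.
(* The same step function on the finer subdivision for which [near_flip] provides signs. *)
pose sig i := tau (iter k half i).
have sigE : Ev (n + k) sig = Ev n tau.
  exact: (E_shift p_gt0 C_gt0 E_lin E_half E_bound n k (fun i => tmean (tau i))).
have := ZP _ _ Zz zP; rewrite -sigE.
have [h' ->] := Ev_split_max tmean_step_marked (n + k) h sig.
move=> le; exists (n + k).+1, (split (step_marked eps) h' sig); split.
- move=> i; have [? ?] := tauM (iter k half i./2).
  split; first exact: in_ball_step_marked.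
  exact: leq_trans (ht_step_marked _ _) _.
- apply: le; apply: le_trans (flip_ge E_bound _ _ _).
  rewrite /alpha ler_pM2l//.
  have -> : pav p (n + k) (fun i => g (iter k half i)) = pav p n g.
    by rewrite /pav (avg_shift n k (fun i => `|g i| `^ p)).
  apply: ge0_ler_powR; rewrite ?nnegrE ?invr_ge0 ?(ltW p_gt0)//.
  + by rewrite mulr_ge0 ?powR_ge0 ?ltW.
  + by rewrite mulr_ge0 ?exprn_ge0// sumr_ge0// => i _; exact: powR_ge0.
  apply: le_trans (ler_wpM2l (powR_ge0 _ _) ns) _.
  by rewrite -avgZ; apply: avg_le => i _; exact: marked_gap.
move=> j; rewrite (avg_split (step_marked eps) (n + k) h' sig (fun t => many t j)).
rewrite -(avg_shift n k); apply: avg_le => i _.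
exact: many_step_marked.
Qed.

(** Each round, an unmarked phase followed by a marked one, uses up one mark and raises the norm by
    [eta], while values in the ball of radius [r] keep the norm below [C * r]. *)
Lemma rounds r s : 0 < r -> 0 < s -> exists2 eta, 0 < eta &
  forall M m n tau, small_trees r M tau -> s <= avg n (fun i => many (tau i) m) ->
  `|Ev n tau| + m%:R * eta <= C * r.
Proof.
move=> r0 s0; have [eta eta0 etaP] := marked_phase r0 s0.
exists eta => // M; elim=> [|m IH] n tau tauM sm.
  have /andP[_] := E_bound n (fun i => tmean (tau i)).
  rewrite mul0r addr0; move/le_trans; apply.
  rewrite ler_pM2l//; apply: pav_ball => // i.
  by apply: tmean_in_ball; case: (tauM i).
have [n1 [tau1 [tauM1 um le1 eq1]]] := unmarked_phase n tauM.
have [|n2 [tau2 [tauM2 le2 eq2]]] := etaP _ n1 _ tauM1 um.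
  apply: le_trans sm _; rewrite -eq1; apply: avg_le => i _; exact: many_le1S.
have := IH n2 tau2 tauM2; rewrite -[m.+1%:R]natr1 mulrDl mul1r => h.
have := h (le_trans (le_trans sm _) (eq2 m)); rewrite eq1 lexx => /(_ isT).
lra.
Qed.

Lemma cnt_bounded_of_amuc r : 0 < r -> exists K : R, forall t, in_ball r t ->
  cnt (fun s => (eps <= s)%R%:R) t <= K.
Proof.
move=> r0; have [eta eta0 etaP] := @rounds r 2^-1 r0 ltac:(by rewrite invr_gt0).
(* Then [m + 1] rounds would gain more than [C * r], so fewer than half of the branches can have
   [m + 1] marks. *)
pose m := Num.truncn (C * r / eta).
exists (2 * m.+1%:R); apply: cnt_bounded => t tr.
rewrite leNgt; apply/negP => tm.
have := etaP (ht t) m.+1 0%N (fun=> t) (fun=> conj tr (leqnn _)).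
rewrite avg_cst => /(_ (ltW tm)).
have : C * r < m.+1%:R * eta by rewrite -ltr_pdivrMr// truncnS_gt.
by have := normr_ge0 (Ev 0 (fun=> t)); lra.
Qed.

End rounds.

(** * Dyadic step functions in the Bochner space *)

Section dyadic_index.
Context (R : realType).
Implicit Types x : R.

(* On [0, 1] the index of the dyadic interval of length 2 ^- n containing x. *)
Definition dyadic_index n x : nat := minn (Num.truncn (2 ^+ n * x)) (2 ^ n).-1.

Lemma dyadic_index_lt n x : (dyadic_index n x < 2 ^ n)%N.
Proof. by rewrite /dyadic_index gtn_min prednK ?expn_gt0// leqnn orbT. Qed.

Lemma half_truncn (y : R) : (Num.truncn (2 * y))./2 = Num.truncn y.
Proof.
have [y0|y0] := leP 0 y; last first.
  have /truncn0Pn -> : ~~ (1 <= 2 * y) by rewrite -ltNge; lra.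
  by have /truncn0Pn -> : ~~ (1 <= y) by rewrite -ltNge; lra.
apply/esym/truncn_def.
have y20 : 0 <= 2 * y by rewrite mulr_ge0.
have := truncn_itv y20; set m := Num.truncn _ => /andP[].
rewrite -{1 2}(odd_double_half m) -[(_ + _).+1%:R]natr1 natrD -mul2n natrM.
rewrite -[(m./2).+1%:R]natr1.
by case: (odd m) => /= ? ?; apply/andP; split; lra.
Qed.

(** The cap, which puts the point 1 into the last interval, is compatible with halving: if
    [2 ^ n = N + 1], the cap at the next generation is [2 * N + 1], whose half is [N]. *)
Lemma dyadic_index_half n x : (dyadic_index n.+1 x)./2 = dyadic_index n x.
Proof.
rewrite /dyadic_index exprS -mulrA expnS.
rewrite -(half_truncn (2 ^+ n * x)); set a := Num.truncn _.
have : (0 < 2 ^ n)%N by rewrite expn_gt0.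
case: (2 ^ n)%N => // N _; rewrite mul2n doubleS /=.
have [aN|Na] := leqP a N.*2.+1.
  rewrite (minn_idPl _)// -[leqRHS](uphalf_double N).
  by rewrite -[uphalf _]/(N.*2.+1./2) half_leq.
rewrite /= uphalf_double (minn_idPr _)//.
by rewrite -[leqLHS](uphalf_double N) -[uphalf _]/(N.*2.+1./2) half_leq// ltnW.
Qed.

Lemma dyadic_index_ge n i x : (i < dyadic_index n x)%N =
  (i.+1 < 2 ^ n)%N && (i.+1%:R / 2 ^+ n <= x).
Proof.
rewrite /dyadic_index leq_min truncn_gt_nat andbC ler_pdivrMr ?exprn_gt0// mulrC.
by rewrite -[in RHS](@prednK (2 ^ n)%N) ?expn_gt0.
Qed.

Lemma measurable_dyadic_index_gt n i :
  measurable ([set x | (i < dyadic_index n x)%N] : set (measurableTypeR R)).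
Proof.
rewrite (_ : [set x | _] = if (i.+1 < 2 ^ n)%N then `[i.+1%:R / 2 ^+ n, +oo[ else set0).
  by case: ifP => _; [exact: measurable_itv|exact: measurable0].
apply/seteqP; split => x /=; rewrite dyadic_index_ge; case: ifP => //=.
  by rewrite in_itv /= andbT.
by rewrite in_itv /= andbT.
Qed.

Lemma measurable_dyadic_index n (A : set nat) :
  measurable (dyadic_index n @^-1` A : set (measurableTypeR R)).
Proof.
rewrite (_ : _ @^-1` _ = \bigcup_(i in A) dyadic_index n @^-1` [set i]); last first.
  by apply/seteqP; split=> [x Ax|x [i Ai] /= ->//]; exists (dyadic_index n x).
apply: bigcup_measurable => -[|i] _.
  rewrite (_ : _ @^-1` _ = ~` [set x | (0 < dyadic_index n x)%N]).
    by apply: measurableC; exact: measurable_dyadic_index_gt.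
  by apply/seteqP; split => x /=; rewrite lt0n; [move=> ->|move/negP; rewrite negbK => /eqP].
rewrite (_ : _ @^-1` _ = [set x | (i < dyadic_index n x)%N] `\`
    [set x | (i.+1 < dyadic_index n x)%N]).
  by apply: measurableD; exact: measurable_dyadic_index_gt.
apply/seteqP; split => x /= [].
  by move=> ->; rewrite ltnSn ltnn.
by move=> h1 /negP; rewrite -leqNgt => h2; apply/eqP; rewrite eqn_leq h1 h2.
Qed.

Lemma lebesgue01_dyadic n i : (i < 2 ^ n)%N ->
  lebesgue01 R (dyadic_index n @^-1` [set i]) = (2^-1 ^+ n)%:E.
Proof.
move=> iN; rewrite /lebesgue01 /= /mrestr.
(* The dyadic intervals are open on the right, except the last one, which contains 1. *)
pose b : bool := (i.+1 < 2 ^ n)%N.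
have n0 : 0 < 2 ^+ n :> R by rewrite exprn_gt0.
have len : (i.+1%:R / 2 ^+ n : R) = i%:R / 2 ^+ n + 2^-1 ^+ n.
  by rewrite -natr1 mulrDl mul1r exprVn.
rewrite (_ : _ `&` _ = [set` Interval (BLeft (i%:R / 2 ^+ n))
    (BSide b (i.+1%:R / 2 ^+ n))]); last first.
  have ge j x : (j < 2 ^ n)%N -> 0 <= x -> (j <= dyadic_index n x)%N = (j%:R / 2 ^+ n <= x).
    case: j => [|j] jn x0; first by rewrite mul0r x0.
    by rewrite dyadic_index_ge jn.
  apply/seteqP; split => x /=; rewrite !in_itv /=.
    move=> [xi /andP[x0 x1]]; apply/andP; split; first by rewrite -(ge i)// xi.
    rewrite /b; case: (ltnP i.+1 (2 ^ n)) => iN' /=.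
      by rewrite ltNge -(ge i.+1)// xi ltnn.
    apply: le_trans x1 _; rewrite ler_pdivlMr// mul1r -natrX ler_nat.
    by [].
  move=> /andP[ix xi].
  have x0 : 0 <= x by apply: le_trans ix; rewrite divr_ge0// ltW.
  split.
    apply/eqP; rewrite eqn_leq ge// ix andbT.
    move: xi; rewrite /b; case: (ltnP i.+1 (2 ^ n)) => iN' /= xi.
      by rewrite leqNgt ge// -ltNge.
    by rewrite leqNgt dyadic_index_ge ltnNge iN'.
  rewrite x0 /=; move: xi; rewrite /b; case: (ltnP i.+1 (2 ^ n)) => iN' /= xi.
    by apply: le_trans (ltW xi) _; rewrite ler_pdivrMr// mul1r -natrX ler_nat ltnW.
  by apply: le_trans xi _; rewrite ler_pdivrMr// mul1r -natrX ler_nat.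
rewrite lebesgue_measure_itv /= lte_fin len ltrDl exprn_gt0 ?invr_gt0//.
by rewrite -EFinD addrAC subrr add0r.
Qed.

Lemma integral_dyadic n (phi : nat -> R) : (forall i, 0 <= phi i) ->
  (\int[lebesgue01 R]_x (phi (dyadic_index n x))%:E = (avg n phi)%:E)%E.
Proof.
move=> phi0.
under eq_integral => x _.
  rewrite (_ : (phi (dyadic_index n x))%:E =
    (\sum_(i < 2 ^ n) ((phi i)%:E * (\1_(dyadic_index n @^-1` [set val i]) x)%:E))%E); last first.
    rewrite (bigD1 (Ordinal (dyadic_index_lt n x)))//= big1 ?adde0.
      by rewrite indicE mem_set// mule1.
    move=> i ix; rewrite indicE memNset ?mule0// => /= xi.
    by move: ix; rewrite -val_eqE /= xi eqxx.
  over.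
rewrite ge0_integral_sum//=.
- rewrite /avg mulr_sumr -sumEFin; apply: eq_bigr => i _.
  rewrite ge0_integralZl_EFin//; last first.
    apply/measurable_EFinP; apply: measurable_indic; exact: measurable_dyadic_index.
  rewrite integral_indic//; last exact: measurable_dyadic_index.
  by rewrite setIT lebesgue01_dyadic// -EFinM mulrC.
- move=> i; apply: measurable_funeM; apply/measurable_EFinP; apply: measurable_indic.
  exact: measurable_dyadic_index.
- by move=> i x _; rewrite mule_ge0 ?lee_fin.
Qed.

End dyadic_index.

Section dyadic_class.
Context (R : realType) (Y : normedModType R) (p : R) (p1 : 1 <= p).
Let mu : {measure set _ -> \bar R} := lebesgue01 R.
Let p_gt0 : 0 < p. Proof. exact: lt_le_trans p1. Qed.

Lemma strongly_measurable_dyadic n (f : nat -> Y) :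
  strongly_measurable (f \o dyadic_index n : measurableTypeR R -> Y).
Proof.
exists (fun=> f \o dyadic_index n); split => [_|x]; last exact: cvg_cst.
split.
  apply: (@sub_finite_set _ _ (f @` `I_(2 ^ n))).
    by move=> _ [x _ <-]; exists (dyadic_index n x) => //=; exact: dyadic_index_lt.
  exact: finite_image (finite_II _).
by move=> y; rewrite comp_preimage; exact: measurable_dyadic_index.
Qed.

Lemma bochner_Lnorm_dyadic n (f : nat -> Y) :
  bochner_Lnorm mu p (f \o dyadic_index n) = (pav p n f)%:E.
Proof.
rewrite bochner_LnormE (integral_dyadic n (phi := fun i => `|f i| `^ p)) ?poweR_EFin//.
Qed.

Lemma dyadic_bochner_pred n (f : nat -> Y) :
  (f \o dyadic_index n : measurableTypeR R -> Y) \in @bochner_pred _ _ R mu Y p p1.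
Proof.
apply/asboolP; split; first exact: strongly_measurable_dyadic.
by rewrite bochner_Lnorm_dyadic ltry.
Qed.

Definition dyadic_class n (f : nat -> Y) : bochner_space mu Y p1 :=
  (\pi_(bochner_space mu Y p1) (BochnerFun (dyadic_bochner_pred n f)))%qT.

Lemma dyadic_class_lin n (a : R) f g :
  dyadic_class n (fun i => a *: f i + g i) = a *: dyadic_class n f + dyadic_class n g.
Proof.
rewrite -[_ *: _]bochner_piZ -bochner_piD; apply/bochner_spaceP.
exact: nearW.
Qed.

Lemma dyadic_class_half n f : dyadic_class n.+1 (fun i => f i./2) = dyadic_class n f.
Proof.
apply/bochner_spaceP; apply: nearW => x /=.
by rewrite dyadic_index_half.
Qed.

Lemma norm_dyadic_class n f : `|dyadic_class n f| = pav p n f.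
Proof. by rewrite -[LHS]/(bochner_norm _) bochner_normE bochner_Lnorm_dyadic. Qed.

Lemma uniformly_convex_of_amuc :
  admits_equiv_norm (@amuc R) (bochner_space mu Y p1) ->
  admits_equiv_norm (@uniformly_convex R) Y.
Proof.
move=> [N amucN]; apply: uniformly_convex_of_bounded_cnt => e e0.
have [c [C [c0 C0 NcC]]] := equiv_norm_bounds N.
apply: (@cnt_bounded_of_amuc R Y (renormed N) p c C dyadic_class) => //.
- exact: dyadic_class_lin.
- exact: dyadic_class_half.
move=> n f; rewrite -norm_dyadic_class; exact: NcC.
Qed.

End dyadic_class.

(** * Uniform convexity passes to the Bochner space *)

Section powR_convexity.
Context (R : realType) (p : R).
Hypothesis p1 : 1 < p.
Let p0 : 0 < p. Proof. exact: lt_trans p1. Qed.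

(* With y = ln t, t ^ p = t e^((p - 1) y) > t (1 + (p - 1) y) and t y >= t - 1. *)
Lemma powR_gt_tangent (t : R) : 0 <= t -> t != 1 -> 1 + p * (t - 1) < t `^ p.
Proof.
rewrite le_eqVlt => /predU1P[<- _|t0 t1].
  by rewrite powR0 ?gt_eqF//; have := p1; lra.
have lnt : 1 - t^-1 <= ln t.
  have := @le_ln1Dx R (t^-1 - 1); rewrite addrCA subrr addr0 lnV ?posrE//.
  by rewrite ltrBDr addrC subrr invr_gt0 => /(_ t0); lra.
have lnt0 : (p - 1) * ln t != 0.
  by rewrite mulf_neq0 ?ln_eq0// subr_eq0 gt_eqF.
have := expR_gt1Dx lnt0; rewrite -(ltr_pM2l t0).
have -> : t * expR ((p - 1) * ln t) = t `^ p.
  rewrite -{1}(lnK (x := t) t0) -expRD /powR gt_eqF//.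
  by congr expR; ring.
apply: le_lt_trans.
have := ler_wpM2l (ltW t0) lnt; rewrite mulrBr divff ?gt_eqF// => h.
have p10 : 0 <= p - 1 by rewrite subr_ge0 ltW.
have := ler_wpM2l p10 h; lra.
Qed.

Lemma powR_ge_tangent (t : R) : 0 <= t -> 1 + p * (t - 1) <= t `^ p.
Proof.
have [->|t1] := eqVneq t 1; first by rewrite subrr mulr0 addr0 powR1.
by move=> t0; apply: ltW; exact: powR_gt_tangent.
Qed.

Lemma powR_ge_tangent_at (m t : R) : 0 < m -> 0 <= t ->
  m `^ p * (1 + p * (t / m - 1)) <= t `^ p.
Proof.
move=> m0 t0; have m_neq0 : m != 0 by rewrite gt_eqF.
rewrite -[X in _ <= X `^ p](divfK m_neq0 t).
rewrite powRM ?(ltW m0) ?divr_ge0 ?(ltW m0)// mulrC ler_wpM2r ?powR_ge0//.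
by apply: powR_ge_tangent; rewrite divr_ge0// ltW.
Qed.

(** In the average of the tangent inequalities at the midpoint [m] the linear terms cancel, since
    [a / m + b / m = 2]. *)
Lemma powR_midpoint (a b : R) : 0 <= a -> 0 <= b ->
  ((a + b) / 2) `^ p <= (a `^ p + b `^ p) / 2.
Proof.
move=> a0 b0; have [ab0|ab0] := leP (a + b) 0.
  have -> : a = 0 by lra.
  have -> : b = 0 by lra.
  by rewrite addr0 mul0r powR0 ?gt_eqF// addr0 mul0r.
pose m := (a + b) / 2; have m0 : 0 < m by rewrite divr_gt0.
have := powR_ge_tangent_at m0 a0; have := powR_ge_tangent_at m0 b0.
have : a / m + b / m = 2 by rewrite -mulrDl /m; field; rewrite gt_eqF.
rewrite -/m; have := powR_ge0 m p.
move: (a / m) (b / m) (m `^ p) => x y q q0 xy hb ha.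
have yE : y = 2 - x by lra.
by rewrite yE in hb; nra.
Qed.

(** The tangent argument for the points 1 and [b], with midpoint [m <= 1 - tau / 2]: as [1 / m] is
    at least [T > 1], the tangent inequality there has a defect of at least [beta], and [m >= 1/2]
    bounds the factor [m ^ p]. *)
Lemma powR_strict_midpoint (tau : R) : 0 < tau -> tau <= 1 ->
  exists2 eta, 0 < eta & forall b, 0 <= b -> b <= 1 - tau ->
    ((1 + b) / 2) `^ p + eta <= (1 + b `^ p) / 2.
Proof.
move=> tau0 tau1.
pose T := (1 - tau / 2)^-1.
have T0 : 0 < T by rewrite invr_gt0; lra.
have T1 : 1 < T by rewrite invf_gt1; lra.
pose beta := T `^ p - (1 + p * (T - 1)).
have beta0 : 0 < beta by rewrite subr_gt0 powR_gt_tangent ?ltW// gt_eqF.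
have TpT : T <= T `^ p.
  have := powR_ge_tangent (ltW T0); have := p1; nra.
exists (2^-1 `^ p * beta / 2); first by rewrite divr_gt0// mulr_gt0// powR_gt0// invr_gt0.
move=> b b0 b1.
pose m := (1 + b) / 2; have m0 : 0 < m by rewrite divr_gt0//; lra.
have mT : m * T <= 1 by rewrite ler_pdivrMr; rewrite /m; lra.
(* The defect at [T] persists at [T * r] for [r >= 1], by the tangent inequality at [r] and
   [T <= T ^ p]. *)
have s_ge : 1 + p * (m^-1 - 1) + beta <= m^-1 `^ p.
  pose r := (m * T)^-1.
  have r1 : 1 <= r by rewrite invf_ge1 // mulr_gt0.
  have sE : m^-1 = T * r by rewrite /r; field; rewrite !gt_eqF.
  rewrite sE powRM ?(ltW T0) ?(le_trans ler01)//.
  have := ler_wpM2l (powR_ge0 T p) (powR_ge_tangent (le_trans ler01 r1)).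
  have r10 : 0 <= p * (r - 1) by apply: mulr_ge0; [exact: ltW|rewrite subr_ge0].
  have := ler_wpM2r r10 TpT; rewrite /beta; lra.
have h1 : m `^ p * (1 + p * (m^-1 - 1) + beta) <= 1.
  apply: le_trans (ler_wpM2l (powR_ge0 _ _) s_ge) _.
  by rewrite -powRM ?invr_ge0 ?(ltW m0)// divff ?gt_eqF// powR1.
have h2 := powR_ge_tangent_at m0 b0.
have h3 : 2^-1 `^ p * beta <= m `^ p * beta.
  rewrite ler_wpM2r ?(ltW beta0)//; apply: ge0_ler_powR; rewrite ?nnegrE ?(ltW p0) ?(ltW m0) ?invr_ge0//.
  by rewrite /m; lra.
have : m^-1 + b / m = 2 by rewrite -{1}(mul1r m^-1) -mulrDl /m; field; rewrite gt_eqF//; lra.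
rewrite -/m; clearbody m; move: h1 h2 h3.
move: (m^-1) (b / m) (m `^ p) (2^-1 `^ p) => x y q q' h1 h2 h3 xy.
have xE : x = 2 - y by lra.
by rewrite xE in h1; nra.
Qed.

End powR_convexity.

Section uniform_convexity.
Context (R : realType) (Y : normedModType R) (p : R).
Hypothesis p1 : 1 < p.
Let p0 : 0 < p. Proof. exact: lt_trans p1. Qed.

Let powR_le (a b : R) : 0 <= a -> a <= b -> a `^ p <= b `^ p.
Proof.
by move=> a0 ab; apply: ge0_ler_powR; rewrite ?nnegrE ?(ltW p0)// (le_trans a0).
Qed.

Lemma norm_powR_midpoint (u v : Y) :
  `|u| `^ p <= (`|u + v| `^ p + `|u - v| `^ p) / 2.
Proof.
apply: le_trans (powR_midpoint p1 _ _) => //; apply: powR_le => //.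
exact: norm_le_midpoint.
Qed.

(** If [|u - v|] is well below 1, strict convexity of the power suffices. Otherwise [u - v] is close
    to its normalisation [y], and uniform convexity of the norm is applied to [u + v] and [y]. *)
Lemma normalized_convexity (e : R) : uniformly_convex Y -> 0 < e -> e <= 1 ->
  exists2 eta, 0 < eta & forall u v : Y, `|u + v| = 1 -> `|u - v| <= 1 ->
    e * `|u| <= `|v| -> `|u| `^ p + eta <= (1 + `|u - v| `^ p) / 2.
Proof.
move=> uc e0 e1.
pose e' := e / 2; have e'0 : 0 < e' by rewrite divr_gt0.
have [|d' d'0 dP'] := uc e' e'0; first by rewrite /e'; lra.
pose d := Num.min d' 1.
have d0 : 0 < d by rewrite lt_min d'0 ltr01.
have d1 : d <= 1 by rewrite ge_min lexx orbT.
have dd' : d <= d' by rewrite ge_min lexx.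
(* In the second case [|y - (u - v)| < tau]: the first bound leaves
   [|u + v - y| >= 2 * e' - tau >= e'], the second makes the error in [|u|] at most [d / 4]. *)
pose tau := Num.min e' (d / 2).
have tau0 : 0 < tau by rewrite lt_min e'0 divr_gt0.
have tau1 : tau <= e' by rewrite ge_min lexx.
have tau2 : tau <= d / 2 by rewrite ge_min lexx orbT.
have [|eta1 eta10 eta1P] := powR_strict_midpoint p1 tau0; first lra.
(* In the second case [|u| <= 1 - 3 * d / 4], while [(1 + b) / 2 >= 1 - d / 4]. *)
pose eta2 := (1 - d / 4) `^ p - (1 - 3 * d / 4) `^ p.
have eta20 : 0 < eta2.
  by rewrite subr_gt0; apply: gt0_ltr_powR => //; rewrite ?nnegrE; lra.
exists (Num.min eta1 eta2); first by rewrite lt_min eta10.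
have m1 : Num.min eta1 eta2 <= eta1 by rewrite ge_min lexx.
have m2 : Num.min eta1 eta2 <= eta2 by rewrite ge_min lexx orbT.
move=> u v uv1 b1 euv; pose b := `|u - v|; rewrite -/b in b1 *.
have b0 : 0 <= b by exact: normr_ge0.
have u_le : `|u| <= (1 + b) / 2 by have := norm_le_midpoint u v; rewrite uv1.
have [bt|bt] := leP b (1 - tau).
  have := eta1P b b0 bt; have := powR_le (normr_ge0 u) u_le; lra.
have v_ge : e' <= `|v| by have := ler_normD u v; rewrite uv1 /e'; nra.
have b_gt0 : 0 < b by rewrite /e' in tau1; lra.
pose y := b^-1 *: (u - v).
have y1 : `|y| = 1 by rewrite normrZ gtr0_norm ?invr_gt0// mulVf// gt_eqF.
have yE : `|y - (u - v)| <= 1 - b.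
  have -> : u - v = b *: y by rewrite scalerA divff ?scale1r// gt_eqF.
  by rewrite -[X in X - _]scale1r -scalerBl normrZ y1 mulr1 ger0_norm// subr_ge0.
have xy : e' <= `|u + v - y|.
  have := ler_normD (u + v - y) (y - (u - v)).
  have -> : u + v - y + (y - (u - v)) = v *+ 2.
    by rewrite addrA subrK opprB [v - u]addrC addrACA subrr add0r mulr2n.
  rewrite normrMn mulr2n; lra.
have := dP' _ _ uv1 y1 xy => xyd.
have u_le' : `|u| <= 1 - 3 * d / 4.
  have := ler_normB (u + v + y) (y - (u - v)).
  have -> : u + v + y - (y - (u - v)) = u *+ 2.
    by rewrite opprB addrACA subrr addr0 addrACA subrr addr0 mulr2n.
  rewrite normrMn mulr2n.
  move: xyd; rewrite normrZ gtr0_norm ?invr_gt0//; lra.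
have := powR_le (normr_ge0 u) u_le'.
have bb : 1 - d / 4 <= (1 + b) / 2 by lra.
have := powR_midpoint p1 ler01 b0; rewrite powR1.
have : (1 - d / 4) `^ p <= ((1 + b) / 2) `^ p by apply: powR_le => //; lra.
by move: m2; rewrite /eta2; lra.
Qed.

(** The term with [e * |u|] absorbs the case of small [v], so that the inequality holds for all
    pairs and can be integrated. Otherwise, changing the sign of [v] and dividing by the larger of
    [|u + v|] and [|u - v|] reduces it to the normalised case. *)
Lemma pointwise_convexity (e : R) : uniformly_convex Y -> 0 < e -> e <= 1 ->
  exists2 eta, 0 < eta & forall u v : Y,
    `|u| `^ p + eta * `|v| `^ p <=
      (`|u + v| `^ p + `|u - v| `^ p) / 2 + eta * (e * `|u|) `^ p.
Proof.
move=> uc e0 e1; have [eta eta0 etaP] := normalized_convexity uc e0 e1.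
exists eta => // u v.
have [uv|vu] := leP (e * `|u|) `|v|; last first.
  have := norm_powR_midpoint u v; have := powR_le (normr_ge0 v) (ltW vu); nra.
suff main (w : Y) : `|w| = `|v| -> `|u - w| <= `|u + w| ->
    `|u| `^ p + eta * `|w| `^ p <= (`|u + w| `^ p + `|u - w| `^ p) / 2.
  apply: le_trans (_ : _ <= (`|u + v| `^ p + `|u - v| `^ p) / 2) _; last first.
    by rewrite lerDl mulr_ge0 ?powR_ge0// ltW.
  have [le|/ltW le] := leP `|u - v| `|u + v|; first exact: main.
  have := main (- v); rewrite normrN opprK [`|u - v| `^ p + _]addrC; exact.
move=> wv le; rewrite -{}wv in uv; pose M := `|u + w|; rewrite -/M in le *.
have uM : `|u| <= M by have := norm_le_midpoint u w; rewrite -/M; lra.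
have wM : `|w| <= M.
  by have := norm_le_midpoint w u; rewrite (addrC w) (distrC w) -/M; lra.
have [M0|M0] := eqVneq M 0.
  have nu : `|u| = 0 by apply/eqP; rewrite eq_le normr_ge0 -M0 uM.
  have nw : `|w| = 0 by apply/eqP; rewrite eq_le normr_ge0 -M0 wM.
  by rewrite nu nw powR0 ?gt_eqF// mulr0 addr0 divr_ge0 ?addr_ge0 ?powR_ge0.
have Mp : 0 < M by rewrite lt_def M0 (le_trans _ uM).
have sc (x : Y) : `|M^-1 *: x| = `|x| / M by rewrite normrZ gtr0_norm ?invr_gt0// mulrC.
have := etaP (M^-1 *: u) (M^-1 *: w).
rewrite -scalerDr -scalerBr !sc divff// => /(_ erefl).
rewrite ler_pdivrMr// mul1r mulrA ler_pdivrMr// divfK ?gt_eqF// => /(_ le uv).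
have pd (x : R) : 0 <= x -> x `^ p = M `^ p * (x / M) `^ p.
  move=> x0; rewrite -powRM ?divr_ge0 ?(ltW Mp)//.
  by rewrite mulrC divfK// gt_eqF.
move/(ler_wpM2l (powR_ge0 M p)) => h.
have := powR_le (normr_ge0 w) wM; rewrite -(ler_pM2l eta0) -/M.
rewrite (pd `|u|)// (pd `|u - w|)//; lra.
Qed.

End uniform_convexity.

(** The whole space serves as the subspace of finite codimension. *)
Lemma amuc_of_uniform_gap (R : realType) (X : normedModType R) :
  (forall t : R, 0 < t -> t < 1 -> exists2 delta : R, 0 < delta &
     forall x z : X, `|x| = 1 -> `|z| = 1 ->
       1 + delta <= Num.max `|x + t *: z| `|x - t *: z|) ->
  amuc X.
Proof.
move=> h t t0 t1; have [d d0 dP] := h t t0 t1.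
apply: (@lt_le_trans _ _ d%:E); first by rewrite lte_fin.
rewrite /amuc_modulus leeBrDl// -EFinD; apply: le_ereal_inf_tmp => _ [x x1 <-].
apply: le_ereal_sup_tmp; exists (ereal_inf [set (Num.max `|x + t *: z|%R `|x - t *: z|%R)%:E
  | z in setT `&` @unit_sphere R X]); last first.
  apply: le_ereal_inf_tmp => _ [z [_ z1] <-].
  by rewrite lee_fin; exact: dP.
exists setT => //; split => //; by exists 0%N, (fun=> 0) => y; exists (fun=> 0).
Qed.

(** * The norm induced on the Bochner space by an equivalent norm of [Y] *)

Section renormed_bochner.
Context d (T : measurableType d) (R : realType).
Variables (mu : {measure set T -> \bar R}) (Y : normedModType R) (N : equiv_norm Y).
Variables (p : R) (p1 : 1 <= p).
Let p0 : 0 < p. Proof. exact: lt_le_trans p1. Qed.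

Definition to_renormed (f : T -> Y) : T -> renormed N := f.

Lemma strongly_measurable_renormed f :
  strongly_measurable f -> strongly_measurable (to_renormed f).
Proof.
move=> [s [ss sf]]; exists (fun n => to_renormed (s n)); split=> [n|x]; first exact: ss.
have [c [C [c0 C0 NC]]] := equiv_norm_bounds N.
apply/cvgrPdist_lt => e e0; have := sf x; move/cvgrPdist_lt => /(_ (e / C)).
move=> /(_ (divr_gt0 e0 C0)); apply: filterS => n.
rewrite ltr_pdivlMr// mulrC; apply: le_lt_trans.
by have /andP[] := NC (f x - s n x).
Qed.

Lemma measurable_norm_powR (Z : normedModType R) (f : T -> Z) :
  strongly_measurable f -> measurable_fun setT (fun x => (`|f x| `^ p)%:E).
Proof.
move=> mf; apply/measurable_EFinP.
apply: (@measurableT_comp _ _ _ _ _ _ (@powR R ^~ p)) => //.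
exact: strongly_measurable_norm.
Qed.

Lemma le_bochner_Lnorm (Z1 Z2 : normedModType R) (f : T -> Z1) (g : T -> Z2) :
  strongly_measurable f -> strongly_measurable g -> (forall x, `|f x| <= `|g x|) ->
  (bochner_Lnorm mu p f <= bochner_Lnorm mu p g)%E.
Proof.
move=> mf mg fg; rewrite !bochner_LnormE.
apply: gt0_ler_poweR; rewrite ?in_itv/= ?leey ?andbT ?integral_ge0//.
- by rewrite invr_ge0 ltW.
apply: ge0_le_integral => //; try exact: measurable_norm_powR.
by move=> x _; rewrite lee_fin ge0_ler_powR ?nnegrE ?(ltW p0).
Qed.

Lemma bochner_Lnorm_renormed_le f (C : R) : strongly_measurable f -> 0 < C ->
  (forall y, N y <= C * `|y|) ->
  (bochner_Lnorm mu p (to_renormed f) <= C%:E * bochner_Lnorm mu p f)%E.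
Proof.
move=> mf C0 NC; rewrite -[X in X%:E](gtr0_norm C0) -(bochner_LnormZ mu p1 _ mf).
apply: le_bochner_Lnorm; first exact: strongly_measurable_renormed.
  exact: strongly_measurableZ.
by move=> x; apply: le_trans (NC _) _; rewrite normrZ gtr0_norm.
Qed.

Lemma bochner_Lnorm_renormed_ge f (c : R) : strongly_measurable f -> 0 < c ->
  (forall y, c * `|y| <= N y) ->
  (c%:E * bochner_Lnorm mu p f <= bochner_Lnorm mu p (to_renormed f))%E.
Proof.
move=> mf c0 Nc; rewrite -[X in X%:E](gtr0_norm c0) -(bochner_LnormZ mu p1 _ mf).
apply: le_bochner_Lnorm; [exact: strongly_measurableZ|exact: strongly_measurable_renormed|].
by move=> x; apply: le_trans (Nc _); rewrite normrZ gtr0_norm.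
Qed.

Implicit Types f g : bochner_fun mu Y p1.

Lemma renormed_fin_num f : bochner_Lnorm mu p (to_renormed f) \is a fin_num.
Proof.
have [c [C [c0 C0 NC]]] := equiv_norm_bounds N.
rewrite ge0_fin_numE ?Lnorm_ge0//.
have NC' y : N y <= C * `|y| by have /andP[] := NC y.
apply: le_lt_trans (bochner_Lnorm_renormed_le (bochner_fun_measurable f) C0 NC') _.
by rewrite lte_mul_pinfty ?lee_fin ?(ltW C0)// -ge0_fin_numE ?Lnorm_ge0// bochner_fun_fin_num.
Qed.

Let X := bochner_space mu Y p1.
Local Notation class f := (\pi_X f)%qT.

Definition renorm (u : X) : R := fine (bochner_Lnorm mu p (to_renormed (repr u))).

Lemma renorm_class f : renorm (class f) = fine (bochner_Lnorm mu p (to_renormed f)).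
Proof.
congr fine; apply: (@bochner_Lnorm_ae _ _ _ mu (renormed N) p).
- exact/strongly_measurable_renormed/bochner_fun_measurable.
- exact/strongly_measurable_renormed/bochner_fun_measurable.
exact: (bochner_repr_ae f).
Qed.

Lemma renormD u v : renorm (u + v) <= renorm u + renorm v.
Proof.
rewrite -[u]reprK -[v]reprK -bochner_piD !renorm_class.
rewrite -lee_fin EFinD !fineK ?renormed_fin_num//.
by apply: (@bochner_LnormD _ _ _ mu (renormed N) p p1);
  exact/strongly_measurable_renormed/bochner_fun_measurable.
Qed.

Lemma renormZ a u : renorm (a *: u) = `|a| * renorm u.
Proof.
rewrite -[u]reprK -[_ *: _]bochner_piZ !renorm_class.
apply: EFin_inj; rewrite EFinM !fineK ?renormed_fin_num//.
by apply: (@bochner_LnormZ _ _ _ mu (renormed N) p p1);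
  exact/strongly_measurable_renormed/bochner_fun_measurable.
Qed.

Lemma renorm_bounds : exists c C : R, [/\ 0 < c, 0 < C &
  forall u, c * `|u| <= renorm u <= C * `|u|].
Proof.
have [c [C [c0 C0 NC]]] := equiv_norm_bounds N.
exists c, C; split=> // u; rewrite -[`|u|]/(bochner_norm u) /bochner_norm /renorm.
have NC1 y : c * `|y| <= N y by have /andP[] := NC y.
have NC2 y : N y <= C * `|y| by have /andP[] := NC y.
rewrite -!lee_fin !EFinM !fineK ?renormed_fin_num ?bochner_fun_fin_num//.
have mu_ := bochner_fun_measurable (repr u).
by rewrite bochner_Lnorm_renormed_ge// bochner_Lnorm_renormed_le.
Qed.

Definition bochner_renorm : equiv_norm X := EquivNorm renormD renormZ renorm_bounds.

Lemma integral_renormed f :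
  (\int[mu]_x (N (f x) `^ p)%:E = (renorm (class f) `^ p)%:E)%E.
Proof.
rewrite renorm_class -poweR_EFin fineK ?renormed_fin_num// bochner_LnormE.
by rewrite -poweRrM mulVf ?gt_eqF// poweRe1// integral_ge0.
Qed.

End renormed_bochner.

(** * The integrated midpoint inequality *)

Section amuc_bochner.
Context d (T : measurableType d) (R : realType).
Variables (mu : {measure set T -> \bar R}) (Y : normedModType R) (N : equiv_norm Y).
Variables (p : R) (p1 : 1 < p).
Let p0 : 0 < p. Proof. exact: lt_trans p1. Qed.
Let X := bochner_space mu Y (ltW p1).
Local Notation class f := (\pi_X f)%qT.
Let norm (u : X) : R := renorm N u.
Implicit Types (f g h : bochner_fun mu Y (ltW p1)) (F G : T -> R).

Lemma integral_lincomb F G (a b I J : R) : 0 <= a -> 0 <= b ->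
  measurable_fun setT F -> measurable_fun setT G ->
  (forall x, 0 <= F x) -> (forall x, 0 <= G x) ->
  (\int[mu]_x (F x)%:E = I%:E)%E -> (\int[mu]_x (G x)%:E = J%:E)%E ->
  (\int[mu]_x (a * F x + b * G x)%:E = (a * I + b * J)%:E)%E.
Proof.
move=> a0 b0 mF mG F0 G0 FI GJ.
have intZ (c : R) (H : T -> R) : 0 <= c -> measurable_fun setT H -> (forall x, 0 <= H x) ->
    (\int[mu]_x (c%:E * (H x)%:E) = c%:E * \int[mu]_x (H x)%:E)%E.
  move=> c0 mH H0; rewrite ge0_integralZl_EFin//; last by apply/measurable_EFinP.
  by move=> x _; rewrite lee_fin.
under eq_integral do rewrite EFinD !EFinM.
rewrite ge0_integralD//=.
- by rewrite !intZ// FI GJ -!EFinM.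
- by move=> x _; rewrite mule_ge0 ?lee_fin.
- by apply: measurable_funeM; apply/measurable_EFinP.
- by move=> x _; rewrite mule_ge0 ?lee_fin.
- by apply: measurable_funeM; apply/measurable_EFinP.
Qed.

Lemma renorm_convexity (e : R) : uniformly_convex (renormed N) -> 0 < e -> e <= 1 ->
  exists2 eta, 0 < eta & forall u v : X,
    norm u `^ p + eta * norm v `^ p <=
      (norm (u + v) `^ p + norm (u - v) `^ p) / 2 + eta * (e * norm u) `^ p.
Proof.
move=> uc e0 e1; have [eta eta0 etaP] := pointwise_convexity p1 uc e0 e1.
exists eta => // u v; rewrite -[u]reprK -[v]reprK.
set f := repr u; set g := repr v.
have cD : class f + class g = class (f + g) by rewrite bochner_piD.
have cB : class f - class g = class (f - g).
  by rewrite -scaleN1r -[-1 *: _]bochner_piZ -bochner_piD scaleN1r.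
have ren0 h : 0 <= norm (class h) by apply: fine_ge0; exact: Lnorm_ge0.
rewrite cD cB powRM ?(ltW e0)//.
pose P (h : bochner_fun mu Y (ltW p1)) (x : T) := N (h x) `^ p.
have P0 h x : 0 <= P h x by exact: powR_ge0.
have mP h : measurable_fun setT (P h).
  apply/measurable_EFinP; apply: (@measurable_norm_powR _ T R p (renormed N) (to_renormed N h)).
  exact/strongly_measurable_renormed/bochner_fun_measurable.
have IP h : (\int[mu]_x (P h x)%:E = (norm (class h) `^ p)%:E)%E.
  exact: integral_renormed.
have epos : 0 <= eta * e `^ p by rewrite mulr_ge0 ?powR_ge0// ltW.
have half0 : 0 <= 2^-1 :> R by rewrite invr_ge0.
have IL := integral_lincomb ler01 (ltW eta0) (mP f) (mP g) (P0 f) (P0 g) (IP f) (IP g).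
have IM := integral_lincomb half0 half0 (mP (f + g)) (mP (f - g))
  (P0 (f + g)) (P0 (f - g)) (IP (f + g)) (IP (f - g)).
have M0 x : 0 <= 2^-1 * P (f + g) x + 2^-1 * P (f - g) x by rewrite addr_ge0 ?mulr_ge0.
have mM : measurable_fun setT (fun x => 2^-1 * P (f + g) x + 2^-1 * P (f - g) x).
  by apply: measurable_funD; apply: measurable_funM.
have IR := integral_lincomb ler01 epos mM (mP f) M0 (P0 f) IM (IP f).
have : ((1 * norm (class f) `^ p + eta * norm (class g) `^ p)%:E <=
  (1 * (2^-1 * norm (class (f + g)) `^ p + 2^-1 * norm (class (f - g)) `^ p) +
    eta * e `^ p * norm (class f) `^ p)%:E)%E.
  rewrite -IL -IR; apply: ge0_le_integral => //.
  - by move=> x _; rewrite lee_fin addr_ge0 ?mulr_ge0// ltW.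
  - by apply/measurable_EFinP; apply: measurable_funD; apply: measurable_funM.
  - by apply/measurable_EFinP; apply: measurable_funD; apply: measurable_funM.
  move=> x _; rewrite lee_fin.
  have key : N (f x) `^ p + eta * N (g x) `^ p <=
      (N (f x + g x) `^ p + N (f x - g x) `^ p) / 2 + eta * (e * N (f x)) `^ p.
    exact: (etaP (f x) (g x)).
  move: key; rewrite powRM ?(ltW e0)//; last exact: (normr_ge0 (f x : renormed N)).
  rewrite -[N (f x) `^ p]/(P f x) -[N (g x) `^ p]/(P g x).
  rewrite -[N (f x + g x) `^ p]/(P (f + g) x) -[N (f x - g x) `^ p]/(P (f - g) x).
  lra.
by rewrite lee_fin; lra.
Qed.

Lemma amuc_bochner_of_uniformly_convex :
  uniformly_convex (renormed N) -> admits_equiv_norm (@amuc R) X.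
Proof.
move=> uc; exists (bochner_renorm mu N (ltW p1)).
apply: amuc_of_uniform_gap => t t0 t1.
(* Any [e] below [t] would do: for unit vectors [x] and [z], the gain [eta * t ^ p] from [t *: z]
   must exceed the error [eta * e ^ p]. *)
have e0 : 0 < t / 2 by rewrite divr_gt0.
have [|eta eta0 etaP] := renorm_convexity uc e0; first lra.
have tp : (t / 2) `^ p < t `^ p.
  by apply: gt0_ltr_powR => //; rewrite ?nnegrE; lra.
pose gam := eta * (t `^ p - (t / 2) `^ p).
have gam0 : 0 < gam by rewrite mulr_gt0// subr_gt0.
exists ((1 + gam) `^ p^-1 - 1).
  have one : 1 `^ p^-1 = 1 :> R by rewrite powR1.
  rewrite subr_gt0 -[ltLHS]one; apply: gt0_ltr_powR; rewrite ?invr_gt0 ?nnegrE//.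
    by rewrite addr_ge0// ltW.
  by rewrite ltrDl.
move=> x z x1 z1; rewrite addrCA subrr addr0.
have {}x1 : norm x = 1 by [].
have {}z1 : norm z = 1 by [].
rewrite -[leRHS]/(Num.max (norm (x + t *: z)) (norm (x - t *: z))).
have := etaP x (t *: z); rewrite /norm renormZ -/(norm z) -/(norm x) x1 z1 !mulr1.
rewrite gtr0_norm// powR1 -/(norm _) -/(norm (x - _)).
set a := norm _; set b := norm _ => h.
have a0 : 0 <= a by apply: fine_ge0; exact: Lnorm_ge0.
have b0 : 0 <= b by apply: fine_ge0; exact: Lnorm_ge0.
have m0 : 0 <= Num.max a b by rewrite le_max a0.
have pm c : 0 <= c -> c <= Num.max a b -> c `^ p <= Num.max a b `^ p.
  by move=> c0 cm; apply: ge0_ler_powR; rewrite ?nnegrE ?(ltW p0).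
have pa : a `^ p <= Num.max a b `^ p by apply: pm => //; rewrite le_max lexx.
have pb : b `^ p <= Num.max a b `^ p by apply: pm => //; rewrite le_max lexx orbT.
have -> : Num.max a b = (Num.max a b `^ p) `^ p^-1.
  by rewrite -powRrM mulfV ?powRr1// gt_eqF.
apply: ge0_ler_powR; rewrite ?nnegrE ?powR_ge0 ?invr_ge0 ?(ltW p0)//.
   by rewrite addr_ge0 ?(ltW gam0).
by rewrite /gam; lra.
Qed.

End amuc_bochner.

Theorem corollary5p5 (R : realType) (Y : completeNormedModType R) (p : R)
    (p1 : 1 < p) :
  admits_equiv_norm (@amuc R) (bochner_space (lebesgue01 R) Y (ltW p1)) <->
  admits_equiv_norm (@uniformly_convex R) Y.
Proof.
split; first exact: uniformly_convex_of_amuc.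
by move=> [N uc]; exact: amuc_bochner_of_uniformly_convex uc.
Qed.
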